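(* The map $A:C^1\to C^1$ (defined in the context) is an almost graph diffeomorphism associated with the solution manifold $X_f=\{\phi\in C^1:\phi'(0)=g(\phi(-d(\phi(0))))\}$ and the closed hyperplane $X_0=\{\chi\in C^1:\chi'(0)=0\}$ of $C^1$.
   Context: Spaces. Let $r>0$. $C=C([-r,0],\mathbb{R})$ is the Banach space of continuous functions with norm $|\phi|_C=\max_{-r\le t\le 0}|\phi(t)|$, and $C^1=C^1([-r,0],\mathbb{R})$ is the Banach space of continuously differentiable functions with norm $|\phi|=|\phi|_C+|\phi'|_C$. Data. $g:\mathbb{R}\to\mathbb{R}$ and $d:\mathbb{R}\to[0,r]$ are continuously differentiable, and $d$ has a single zero $\eta_0\in\mathbb{R}$ (so $d(\eta_0)=0$ and $d(\eta)>0$ for $\eta\neq\eta_0$). $L:C\to\mathbb{R}$ is $L\phi=\phi(0)$, and for $\eta\in\mathbb{R}$, $L_\eta:C\to\mathbb{R}$ is $L_\eta\phi=\phi(-d(\eta))$. The solution manifold of $x'(t)=g(x(t-d(x(t))))$ is $$X_f=\{\phi\in C^1:\phi'(0)=g(\phi(-d(L\phi)))\},$$ a continuously differentiable submanifold of codimension 1 in $C^1$, with tangent space at $\phi\in X_f$ $$T_\phi X_f=\{\chi\in C^1:\chi'(0)=g'(\phi(-d(L\phi)))[\chi(-d(L\phi))-\phi'(-d(L\phi))d'(L\phi)L\chi]\}.$$ Also $X_0=\{\chi\in C^1:\chi'(0)=0\}$. Constants. Fix $\rho>0$ and set $c=\max_{|\xi-\eta_0|\le\rho}|g(\xi)|+\max_{|\xi-\eta_0|\le\rho}|g'(\xi)|$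 and $c_*=\frac{\rho}{4(c+1)(\rho+3)}$. Functions $\psi_\eta$. Fix $\psi_{\eta_0}\in C^1$ with $\psi_{\eta_0}(0)=0$, $\psi_{\eta_0}'(0)=1$, $|\psi_{\eta_0}|_C\le c_*$. Fix a continuously differentiable map $\mathbb{R}\setminus\{\eta_0\}\ni\eta\mapsto\psi_\eta\in C^1$ such that for every $\eta\ne\eta_0$: $\psi_\eta(t)=0$ on $[-r,-d(\eta)]\cup\{0\}$, $\psi_\eta'(0)=1$, $|\psi_\eta|_C\le c_*$, and $\psi_\eta\notin T_\phi X_f$ for all $\phi\in X_f$ with $L\phi=\eta$ (such a map exists). Cut-off. Fix a continuously differentiable $a:\mathbb{R}\to[0,1]$ with $a(\xi)=1$ for $|\xi-\eta_0|\le\rho/2$, $a(\xi)=0$ for $|\xi-\eta_0|\ge\rho$, and $|a'(\xi)|\le 3/\rho$ for $\rho/2\le|\xi-\eta_0|\le\rho$. The map $A$. Let $C^1_{\rho/2}=\{\phi\in C^1:|\phi(-d(L\phi))-\eta_0|<\rho/2\}$ and $C^1_+=\{\phi\in C^1:d(L\phi)>0\}$; these open sets cover $C^1$. With $\eta=L\phi$ and $\tau=L_\eta\phi=\phi(-d(L\phi))$, define $$A(\phi)=\phi-g(\tau)\psi_{\eta_0}\ \text{ for }\phi\in C^1_{\rho/2},\qquad A(\phi)=\phi-g(\tau)[a(\tau)\psi_{\eta_0}+(1-a(\tau))\psi_\eta]\ \text{ for }\phi\in C^1_+.$$ The two formulas agree on $C^1_{\rho/2}\cap C^1_+$, so $A:C^1\to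 C^1$ is well defined. Almost graph diffeomorphism. Let $X$ be a continuously differentiable submanifold of a Banach space $E$ and $H\subset E$ a closed subspace with a closed complementary space. A diffeomorphism $A$ (continuously differentiable with continuously differentiable inverse) from an open neighbourhood $\mathcal{O}$ of $X$ in $E$ onto an open subset of $E$ is called an almost graph diffeomorphism associated with $X$ and $H$ if $A(X)\subset H$ and $A(\zeta)=\zeta$ for all $\zeta\in X\cap H$. Here $E=\mathcal{O}=C^1$, $X=X_f$, $H=X_0$. *)

(* Defs.v *)
From HB Require Import structures.
From mathcomp Require Import all_boot all_order all_algebra.
From mathcomp Require Import all_classical all_reals all_analysis.
From mathcomp Require Import lra.
Import Order.TTheory GRing.Theory Num.Theory.
Import numFieldNormedType.Exports.
Set Implicit Arguments.
Unset Strict Implicit.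
Unset Printing Implicit Defensive.
Local Open Scope ring_scope.
Local Open Scope classical_set_scope.

Section Sup.
Context {R : realType}.
Implicit Types (A : set R) (f : R -> R).

Definition sup_on (A : set R) (f : R -> R) : R := sup [set `|f t| | t in A].

Lemma sup_on_ub (a b : R) f t : continuous f ->
  a <= t <= b -> `|f t| <= sup_on `[a, b] f.
Proof.
move=> cf tab; have ab : a <= b by have /andP[ta tb] := tab; exact: le_trans ta tb.
have cn : {within `[a, b], continuous (fun x => `|f x|)}.
  apply: continuous_subspaceT => x.
  by apply: continuous_comp; [exact: cf | exact: norm_continuous].
have [c _ cmax] := EVT_max ab cn.
apply: ub_le_sup.
  by exists `|f c| => _ /= [x xab <-]; apply: cmax.
by exists t => //=; rewrite in_itv.
Qed.

Lemma sup_on_le A f M : A !=set0 -> (forall t, A t -> `|f t| <= M) ->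
  sup_on A f <= M.
Proof.
move=> [x Ax] fM; apply: ge_sup; first by exists `|f x|, x.
by move=> _ [t At <-]; exact: fM.
Qed.

End Sup.

Section C1space.
Context {R : realType}.
Variable r : {posnum R}.

(* A C^1 function on [-r, 0] is represented by its unique C^1 extension to R
   that is affine on ]-oo, -r] and on [0, +oo[ (see C1seg_of_segment and
   C1seg_on_segment). Its one-sided derivatives at -r and at 0 are the values
   there of the ordinary derivative of the extension. *)
Definition is_C1seg (f : R -> R) : Prop :=
  [/\ forall t, derivable f t 1,
      continuous (derive1 f),
      forall t, t <= - r%:num -> derive1 f t = derive1 f (- r%:num)
    & forall t, 0 <= t -> derive1 f t = derive1 f 0].

Definition C1seg_pred : {pred R -> R} := mem [set f | is_C1seg f].

Record C1seg := MkC1seg { C1seg_fun :> R -> R ; _ : C1seg_fun \in C1seg_pred }.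

HB.instance Definition _ := [isSub for C1seg_fun].
HB.instance Definition _ := [Choice of C1seg by <:].

Lemma derive1_lin (a : R) (f g : R -> R) t :
  derivable f t 1 -> derivable g t 1 ->
  derivable (a *: f + g) t 1 /\ derive1 (a *: f + g) t = a * derive1 f t + derive1 g t.
Proof.
move=> df dg; have daf : derivable (a *: f) t 1 by exact: derivableZ.
split; first exact: derivableD.
by rewrite !derive1E deriveD// deriveZ.
Qed.

Lemma C1seg_submod_closed : submod_closed C1seg_pred.
Proof.
split.
  rewrite inE; have d0 t : derive1 (0 : R -> R) t = 0 by rewrite derive1_cst.
  have dE : derive1 (0 : R -> R) = cst 0 by apply/funext => t; rewrite d0.
  split.
  - by move=> t; exact: derivable_cst.
  - by rewrite dE; exact: cst_continuous.
  - by move=> t _; rewrite !d0.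
  - by move=> t _; rewrite !d0.
move=> a f g; rewrite !inE => -[df cf nf pf] [dg cg ng pg].
have dE t := (derive1_lin a (df t) (dg t)).2.
have dF t := (derive1_lin a (df t) (dg t)).1.
split => //.
- have -> : (derive1 (a *: f + g)) = (fun t => a * derive1 f t + derive1 g t).
    by apply/funext => t; rewrite dE.
  move=> t; apply: cvgD; last exact: cg.
  by apply: cvgM; [exact: cvg_cst | exact: cf].
- by move=> t tr; rewrite !dE nf // ng.
- by move=> t tr; rewrite !dE pf // pg.
Qed.

HB.instance Definition _ :=
  GRing.isSubmodClosed.Build _ _ C1seg_pred C1seg_submod_closed.
HB.instance Definition _ := [SubChoice_isSubLmodule of C1seg by <:].

Lemma C1segP (phi : C1seg) : is_C1seg phi.
Proof. by case: phi => f /=; rewrite inE. Qed.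

Lemma C1seg_derivable (phi : C1seg) t : derivable phi t 1.
Proof. by case: (C1segP phi). Qed.
Arguments C1seg_derivable : clear implicits.

Lemma C1seg_continuous (phi : C1seg) : continuous phi.
Proof.
move=> t; apply: differentiable_continuous; apply/derivable1_diffP.
exact: C1seg_derivable.
Qed.
Arguments C1seg_continuous : clear implicits.

Lemma C1seg_derive_continuous (phi : C1seg) : continuous (derive1 phi).
Proof. by case: (C1segP phi). Qed.
Arguments C1seg_derive_continuous : clear implicits.

Lemma C1seg_derive_lin (a : R) (phi chi : C1seg) t :
  derive1 (a *: phi + chi : C1seg) t = a * derive1 phi t + derive1 chi t.
Proof.
have -> : (a *: phi + chi : C1seg) = a *: C1seg_fun phi + chi :> (R -> R) by [].
exact: (derive1_lin a (C1seg_derivable phi t) (C1seg_derivable chi t)).2.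
Qed.

Lemma C1seg_deriveD (phi chi : C1seg) t :
  derive1 (phi + chi : C1seg) t = derive1 phi t + derive1 chi t.
Proof. by have := C1seg_derive_lin 1 phi chi t; rewrite scale1r mul1r. Qed.

Lemma C1seg_derive0 t : derive1 (0 : C1seg) t = 0.
Proof. by rewrite derive1_cst. Qed.

Lemma C1seg_deriveZ a (phi : C1seg) t :
  derive1 (a *: phi : C1seg) t = a * derive1 phi t.
Proof.
by have := C1seg_derive_lin a phi 0 t; rewrite addr0 C1seg_derive0 addr0.
Qed.

Definition normC (f : R -> R) : R := sup_on `[- r%:num, 0] f.

Definition normC1 (phi : C1seg) : R := normC phi + normC (derive1 phi).

Let seg_nonempty : (`[- r%:num, 0] : set R) !=set0.
Proof. by exists 0; rewrite /= in_itv /= lexx oppr_le0 ltW. Qed.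

Lemma normC_ub (f : R -> R) t : continuous f -> - r%:num <= t <= 0 ->
  `|f t| <= normC f.
Proof. exact: sup_on_ub. Qed.

Lemma normC_le (f : R -> R) M :
  (forall t, - r%:num <= t <= 0 -> `|f t| <= M) -> normC f <= M.
Proof.
by move=> fM; apply: sup_on_le seg_nonempty _ => t; rewrite /= in_itv; exact: fM.
Qed.

Lemma normC_ge0 (f : R -> R) : continuous f -> 0 <= normC f.
Proof.
move=> cf; apply: le_trans (normC_ub cf (_ : - r%:num <= 0 <= 0)) => //.
by rewrite lexx oppr_le0 ltW.
Qed.

Lemma normC_add (f g : R -> R) : continuous f -> continuous g ->
  normC (fun t => f t + g t) <= normC f + normC g.
Proof.
move=> cf cg; apply: normC_le => t ht.
by apply: (le_trans (ler_normD _ _)); rewrite lerD // normC_ub.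
Qed.

Lemma normC_scale a (f : R -> R) : continuous f ->
  normC (fun t => a * f t) = `|a| * normC f.
Proof.
move=> cf; apply/eqP; rewrite eq_le; apply/andP; split.
  by apply: normC_le => t ht; rewrite normrM ler_wpM2l // normC_ub.
have caf : continuous (fun t => a * f t).
  by move=> t; apply: cvgM; [exact: cvg_cst | exact: cf].
have [->|a0] := eqVneq a 0.
  rewrite normr0 mul0r; apply: normC_ge0.
  have -> : (fun t => 0 * f t) = cst 0 by apply/funext => t; rewrite mul0r.
  exact: cst_continuous.
rewrite mulrC -ler_pdivlMr ?normr_gt0 //; apply: normC_le => t ht.
by rewrite ler_pdivlMr ?normr_gt0 // mulrC -normrM; exact: (normC_ub caf).
Qed.

Let normC1_D (phi chi : C1seg) : normC1 (phi + chi) <= normC1 phi + normC1 chi.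
Proof.
have -> : normC1 (phi + chi) = normC (fun t => phi t + chi t)
    + normC (fun t => derive1 phi t + derive1 chi t).
  rewrite /normC1; congr (_ + normC _).
  by apply/funext => t; rewrite C1seg_deriveD.
rewrite /normC1 addrACA; apply: lerD; apply: normC_add;
  exact: C1seg_continuous || exact: C1seg_derive_continuous.
Qed.

Let normC1_Z a (phi : C1seg) : normC1 (a *: phi) = `|a| * normC1 phi.
Proof.
rewrite /normC1 mulrDr -normC_scale; last exact: C1seg_continuous.
rewrite -normC_scale; last exact: C1seg_derive_continuous.
by congr (_ + normC _); apply/funext => t; rewrite C1seg_deriveZ.
Qed.

Lemma C1seg_derive_clamp (phi : C1seg) t :
  exists2 s, - r%:num <= s <= 0 & derive1 phi t = derive1 phi s.
Proof.
have [_ _ n p] := C1segP phi; have r0 : 0 < r%:num by [].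
have [/n ->|rt] := leP t (- r%:num).
  by exists (- r%:num) => //; rewrite lexx oppr_le0 ltW.
have [/p ->|t0] := leP 0 t.
  by exists 0 => //; rewrite lexx oppr_le0 ltW.
by exists t => //; rewrite !ltW.
Qed.

Lemma C1seg_derive_le (phi : C1seg) t : `|derive1 phi t| <= normC (derive1 phi).
Proof.
have [s hs ->] := C1seg_derive_clamp phi t.
by apply: normC_ub => //; exact: C1seg_derive_continuous.
Qed.

Lemma C1seg_lipschitz (phi : C1seg) s t :
  `|phi t - phi s| <= normC (derive1 phi) * `|t - s|.
Proof.
wlog st : s t / s <= t.
  move=> H; have [st|/ltW ts] := leP s t; first exact: H.
  by rewrite distrC (distrC t); exact: H.
have [x _ ->] := @MVT_segment _ phi (derive1 phi) s t st
  (fun x _ => DeriveDef (C1seg_derivable phi x) (esym (derive1E _ _)))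
  (continuous_subspaceT (C1seg_continuous phi)).
by rewrite normrM ler_wpM2r // C1seg_derive_le.
Qed.

Let normC1_eq0 (phi : C1seg) : normC1 phi = 0 -> phi = 0.
Proof.
have h1 := normC_ge0 (C1seg_continuous phi).
have h2 := normC_ge0 (C1seg_derive_continuous phi).
move=> /eqP; rewrite paddr_eq0 // => /andP[/eqP n0 /eqP n1].
apply/val_inj/funext => t /=.
have phi00 : phi 0 = 0.
  apply/eqP; rewrite -normr_le0 -[leRHS]n0.
  by apply: normC_ub; [exact: C1seg_continuous | rewrite lexx oppr_le0 ltW].
have := C1seg_lipschitz phi 0 t.
by rewrite n1 mul0r phi00 subr0 normr_le0 => /eqP.
Qed.

HB.instance Definition _ :=
  Lmodule_isNormed.Build R C1seg normC1_D normC1_Z normC1_eq0.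

Lemma C1seg_normE (phi : C1seg) : `|phi| = normC phi + normC (derive1 phi).
Proof. by []. Qed.

End C1space.

Arguments C1seg_derivable {R r} phi t : rename.
Arguments C1seg_continuous {R r} phi : rename.
Arguments C1seg_derive_continuous {R r} phi : rename.

Section C1space_complete.
Context {R : realType}.
Variable r : {posnum R}.
Local Notation C1seg := (C1seg r).

Lemma C1seg_deriveB (phi chi : C1seg) t :
  derive1 (phi - chi : C1seg) t = derive1 phi t - derive1 chi t.
Proof.
have := C1seg_derive_lin (- 1) chi phi t.
by rewrite scaleN1r mulN1r addrC [RHS]addrC.
Qed.

Lemma diffquot_cvgP (f : R -> R) (t l : R) :
  (h^-1 *: (f (h + t) - f t) @[h --> 0^'] --> l) <->
  (forall e, 0 < e -> \forall s \near t,
     s != t -> `|(s - t)^-1 * (f s - f t) - l| < e).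
Proof.
split=> [/cvgrPdist_lt fl e e0|H].
  have : \forall h \near (0 : R),
      h != 0 -> `|l - h^-1 *: (f (h + t) - f t)| < e := fl _ e0.
  rewrite (near_shift t 0) sub0r; apply: filterS => s /= {}H st.
  by rewrite distrC; move: H; rewrite subrK; apply; rewrite subr_eq0.
apply/cvgrPdist_lt => e e0.
suff : \forall h \near (0 : R),
   h != 0 -> `|l - h^-1 *: (f (h + t) - f t)| < e by [].
have := H _ e0; rewrite (near_shift 0 t) subr0; apply: filterS => s /= {}H st.
by rewrite distrC; move: H; rewrite addrK; apply; rewrite -subr_eq0 addrK.
Qed.

Lemma derivable_diffquotE (f : R -> R) (t : R) :
  (fun h : R => h^-1 *: ((f \o shift t) (h *: 1) - f t)) =
  (fun h => h^-1 *: (f (h + t) - f t)).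
Proof. by apply/funext => h /=; rewrite [h%:A]mulr1. Qed.

Lemma diffquot_derive (f : R -> R) (t l : R) :
  (forall e, 0 < e -> \forall s \near t,
     s != t -> `|(s - t)^-1 * (f s - f t) - l| < e) ->
  derivable f t 1 /\ derive1 f t = l.
Proof.
move=> /diffquot_cvgP fl; split; last exact: cvg_lim fl.
by rewrite /derivable derivable_diffquotE; apply/cvg_ex; exists l.
Qed.

Lemma derive_diffquot (f : R -> R) (t : R) : derivable f t 1 ->
  forall e, 0 < e -> \forall s \near t,
     s != t -> `|(s - t)^-1 * (f s - f t) - derive1 f t| < e.
Proof.
rewrite /derivable derivable_diffquotE => df; exact/diffquot_cvgP.
Qed.

Lemma lim_dist_le (T : Type) (F : set_system T) (FF : ProperFilter F)
    (u : T -> R) (l c e : R) :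
  u x @[x --> F] --> l -> (\forall x \near F, `|u x - c| <= e) -> `|l - c| <= e.
Proof.
move=> ul ue; apply: (closed_cvg (fun y => `|y - c| <= e)) ue _ ul.
apply: (@preimage_closed _ _ (fun y : R => `|y - c|) [set y | y <= e]).
  by move=> y _; apply: cvg_norm; apply: cvgB; [exact: cvg_id | exact: cvg_cst].
exact: closed_le.
Qed.

Lemma C1seg_eval_le (phi : C1seg) t : `|phi t| <= (1 + `|t|) * `|phi|.
Proof.
have h0 : `|phi 0| <= normC r phi.
  apply: normC_ub; [exact: C1seg_continuous | by rewrite lexx oppr_le0 ltW].
have d0 := normC_ge0 r (C1seg_derive_continuous phi).
have n0 := normC_ge0 r (C1seg_continuous phi).
have := C1seg_lipschitz phi 0 t; rewrite subr0 => ht.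
have hD := ler_normD (phi t - phi 0) (phi 0); rewrite subrK in hD.
have t0 := normr_ge0 t.
rewrite C1seg_normE; nra.
Qed.

Lemma C1seg_deriv_le (phi : C1seg) t : `|derive1 phi t| <= `|phi|.
Proof.
apply: le_trans (C1seg_derive_le phi t) _.
by rewrite C1seg_normE lerDr normC_ge0 //; exact: C1seg_continuous.
Qed.

Let split3 (e : R) : e / 3 + e / 3 + e / 3 = e.
Proof. lra. Qed.

Lemma C1seg_complete (F : set_system C1seg) :
  ProperFilter F -> cauchy F -> cvg F.
Proof.
move=> FF /cauchyP Fc.
have cv (u : C1seg -> R) (M : R) : 0 < M ->
    (forall p q : C1seg, `|u p - u q| <= M * `|p - q|) -> cvg (u x @[x --> F]).
  move=> M0 uM; apply: cauchy_cvg; apply/cauchyP => e e0.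
  have [p Fp] := Fc _ (divr_gt0 e0 M0); exists (u p).
  suff : F [set q | ball (u p) e (u q)] by [].
  apply: filterS Fp => q; rewrite -!ball_normE /= => pq.
  by apply: le_lt_trans (uM _ _) _; rewrite mulrC -ltr_pdivlMr.
have cve t : cvg ((p : C1seg) t @[p --> F]).
  apply: (cv _ (1 + `|t|)) => [|p q]; first by rewrite ltr_wpDr.
  exact: (C1seg_eval_le (p - q) t).
have cvd t : cvg (derive1 (p : C1seg) t @[p --> F]).
  apply: (cv _ 1) => // p q; rewrite mul1r -C1seg_deriveB.
  exact: C1seg_deriv_le.
pose g t := lim ((p : C1seg) t @[p --> F]).
pose h t := lim (derive1 (p : C1seg) t @[p --> F]).
have gE t : (p : C1seg) t @[p --> F] --> g t by exact: cve.
have hE t : derive1 (p : C1seg) t @[p --> F] --> h t by exact: cvd.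
have approx e : 0 < e -> exists p : C1seg, [/\ F (ball p e),
    forall t, `|h t - derive1 p t| <= e,
    forall t, - r%:num <= t <= 0 -> `|g t - p t| <= e &
    forall s t, `|(g t - g s) - (p t - p s)| <= e * `|t - s|].
  move=> e0; have [p Fp] := Fc _ e0; exists p.
  have Fp' : \forall q \near F, `|q - p| < e.
    by apply: filterS Fp => q; rewrite -ball_normE /= distrC.
  split=> // [t|t ht|s t].
  - apply: (lim_dist_le FF (hE t)); apply: filterS Fp' => q /ltW; apply: le_trans.
    by rewrite -C1seg_deriveB; exact: C1seg_deriv_le.
  - apply: (lim_dist_le FF (gE t)); apply: filterS Fp' => q /ltW; apply: le_trans.
    have := normC_ub (C1seg_continuous (q - p)) ht; move/le_trans; apply.
    rewrite C1seg_normE lerDl normC_ge0 //; exact: C1seg_derive_continuous.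
  - apply: (lim_dist_le FF (cvgB (gE t) (gE s))).
    apply: filterS Fp' => q /ltW qp.
    have := C1seg_lipschitz (q - p) s t.
    have -> : (q - p) t - (q - p) s = q t - q s - (p t - p s).
      change (q t - p t - (q s - p s) = q t - q s - (p t - p s)).
      by rewrite !opprB addrACA [RHS]addrACA (addrC (- q s)).
    move=> /le_trans; apply; rewrite ler_wpM2r //; apply: le_trans qp.
    by rewrite C1seg_normE lerDr normC_ge0 //; exact: C1seg_continuous.
have gd t : derivable g t 1 /\ derive1 g t = h t.
  apply: diffquot_derive => e e0.
  have e3 : 0 < e / 3 by rewrite divr_gt0.
  have [p [_ hp _ gp]] := approx _ e3.
  have := derive_diffquot (C1seg_derivable p t) e3.
  apply: filterS => s H st; have {}H := H st.
  have h1 : `|(s - t)^-1 * (g s - g t - (p s - p t))| <= e / 3.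
    rewrite normrM normfV ler_pdivrMl ?normr_gt0 ?subr_eq0 //.
    by rewrite mulrC; exact: gp.
  have h2 := hp t.
  have -> : (s - t)^-1 * (g s - g t) - h t =
     (s - t)^-1 * (g s - g t - (p s - p t))
     + ((s - t)^-1 * (p s - p t) - derive1 p t) - (h t - derive1 p t).
    rewrite mulrBr; lra.
  have b1 := ler_normB ((s - t)^-1 * (g s - g t - (p s - p t))
     + ((s - t)^-1 * (p s - p t) - derive1 p t)) (h t - derive1 p t).
  have b2 := ler_normD ((s - t)^-1 * (g s - g t - (p s - p t)))
     ((s - t)^-1 * (p s - p t) - derive1 p t).
  lra.
have dgE : derive1 g = h by apply/funext => t; exact: (gd t).2.
have hc : continuous h.
  move=> t; apply/cvgrPdist_lt => e e0.
  have e3 : 0 < e / 3 by rewrite divr_gt0.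
  have [p [_ hp _ _]] := approx _ e3.
  have /cvgrPdist_lt/(_ _ e3) := C1seg_derive_continuous p t.
  apply: filterS => s H; have h1 := hp t; have h2 := hp s.
  have -> : h t - h s = h t - derive1 p t + (derive1 p t - derive1 p s)
    - (h s - derive1 p s).
    by rewrite opprB !addrA !subrK.
  have b1 := ler_normB (h t - derive1 p t + (derive1 p t - derive1 p s))
    (h s - derive1 p s).
  have b2 := ler_normD (h t - derive1 p t) (derive1 p t - derive1 p s).
  lra.
have hcst t s : (forall p : C1seg, derive1 p t = derive1 p s) -> h t = h s.
  move=> H; rewrite /h.
  suff -> : (fun p : C1seg => derive1 p t) = (fun p => derive1 p s) by [].
  by apply/funext => p; exact: H.
have hn t : t <= - r%:num -> h t = h (- r%:num).
  by move=> tr; apply: hcst => p; have [_ _ n _] := C1segP p; exact: n.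
have h0p t : 0 <= t -> h t = h 0.
  by move=> tr; apply: hcst => p; have [_ _ _ n] := C1segP p; exact: n.
have gP : g \in C1seg_pred r.
  apply/mem_set; split.
  - by move=> t; exact: (gd t).1.
  - by rewrite dgE; exact: hc.
  - by rewrite dgE; exact: hn.
  - by rewrite dgE; exact: h0p.
pose G : C1seg := MkC1seg gP.
apply/cvg_ex; exists G; apply/cvgrPdist_lt => e e0.
have e3 : 0 < e / 3 by rewrite divr_gt0.
have [p [Fp hpp gp _]] := approx _ e3.
have Gp : `|G - p| <= e / 3 + e / 3.
  rewrite C1seg_normE; apply: lerD; apply: normC_le => t ht.
    exact: gp.
  by rewrite C1seg_deriveB /= dgE.
apply: filterS Fp => q; rewrite -ball_normE /= => pq.
have H : `|G - q| <= `|G - p| + `|p - q| by exact: ler_distD.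
apply: le_lt_trans H _; rewrite -[ltRHS]split3.
by apply: ler_ltD Gp pq.
Qed.

HB.instance Definition _ := Uniform_isComplete.Build C1seg C1seg_complete.

End C1space_complete.

Section C1space_segment.
Context {R : realType}.
Variable r : {posnum R}.
Local Notation I := (`[- r%:num, 0] : set R).

(* f is C^1 on [-r, 0] with derivative df, one-sided at the end points; the
   values of f and df outside of [-r, 0] are irrelevant. *)
Definition is_C1_on_segment (f df : R -> R) : Prop :=
  {within I, continuous df} /\
  forall t, I t ->
    (s - t)^-1 * (f s - f t) @[s --> within I t^'] --> df t.

Lemma C1seg_on_segment (phi : C1seg r) : is_C1_on_segment phi (derive1 phi).
Proof.
split; first exact: continuous_subspaceT (C1seg_derive_continuous phi).
move=> t _; apply: (cvg_trans (cvg_app _ (cvg_within _))).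
apply/cvgrPdist_lt => e e0.
have := derive_diffquot (C1seg_derivable phi t) e0.
suff : (\forall s \near t, s != t ->
    `|(s - t)^-1 * (phi s - phi t) - derive1 phi t| < e) ->
  \forall s \near t, s != t ->
    `|derive1 phi t - (s - t)^-1 * (phi s - phi t)| < e by [].
by apply: filterS => s H st; rewrite distrC; exact: H.
Qed.

Let clamp (t : R) : R := if t < - r%:num then - r%:num else if 0 < t then 0 else t.

Let r0 : 0 < r%:num. Proof. by []. Qed.

Let clamp_in t : I (clamp t).
Proof.
rewrite /= in_itv /= /clamp.
case: ltP => [_|h1]; first by rewrite lexx oppr_le0 ltW.
case: ltP => [_|h2]; last by rewrite h1 h2.
by rewrite lexx oppr_le0 ltW.
Qed.

Let clamp_id t : I t -> clamp t = t.
Proof.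
rewrite /= in_itv /= /clamp => /andP[h1 h2].
by rewrite ltNge h1 /= ltNge h2.
Qed.

Let clamp_lip s t : `|clamp t - clamp s| <= `|t - s|.
Proof.
wlog st : s t / s <= t.
  move=> H; have [st|/ltW ts] := leP s t; first exact: H.
  by rewrite distrC (distrC t); exact: H.
have rr := r0.
have h : 0 <= clamp t - clamp s <= t - s.
  rewrite /clamp; case: ltP => h1; case: ltP => h2;
  (try case: ltP => h3); (try case: ltP => h4); apply/andP; split; lra.
by case/andP: h => h1 h2; rewrite !ger0_norm // subr_ge0.
Qed.

Lemma C1seg_of_segment (f df : R -> R) : is_C1_on_segment f df ->
  exists2 phi : C1seg r,
    forall t, I t -> phi t = f t /\ derive1 phi t = df t &
    forall psi : C1seg r, (forall t, I t -> psi t = f t) -> psi = phi.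
Proof.
move=> [/subspace_continuousP dfc fd].
pose F t := f (clamp t) + df (clamp t) * (t - clamp t).
have FE t : I t -> F t = f t.
  by move=> It; rewrite /F clamp_id // subrr mulr0 addr0.
have Fd t : derivable F t 1 /\ derive1 F t = df (clamp t).
  apply: diffquot_derive => e e0.
  have quot s : s != t -> clamp s = clamp t ->
      `|(s - t)^-1 * (F s - F t) - df (clamp t)| < e.
    move=> st sE; rewrite /F sE opprD addrACA subrr add0r -mulrBr.
    rewrite (_ : s - _ - _ = s - t); last by rewrite opprB addrA subrK.
    by rewrite mulrCA mulVf ?subr_eq0 // mulr1 subrr normr0.
  have [tr|rt] := ltP t (- r%:num).
    near=> s => st; apply: quot => //.
    have sr : s < - r%:num by near: s; exact: lt_nbhsl.
    by rewrite /clamp tr sr.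
  have [t0|t0] := ltP 0 t.
    near=> s => st; apply: quot => //.
    have s0 : 0 < s by near: s; exact: lt_nbhsr.
    have rr := r0.
    have sN : (s < - r%:num) = false by apply/negbTE; rewrite -leNgt; lra.
    have tN : (t < - r%:num) = false by apply/negbTE; rewrite -leNgt; lra.
    by rewrite /clamp s0 t0 sN tN.
  have It : I t by rewrite /= in_itv /= rt t0.
  have /cvgrPdist_lt/(_ _ e0) near1 := fd t It.
  have {}near1 : \forall s \near t, s != t -> I s ->
      `|df t - (s - t)^-1 * (f s - f t)| < e by [].
  have near2 : \forall s \near t, 0 < s -> t = 0.
    have [->|tn] := eqVneq t 0; first by near=> s.
    have {}tn : t < 0 by rewrite lt_neqAle tn.
    near=> s => s0; have : s < 0 by near: s; exact: lt_nbhsl.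
    by rewrite ltNge (ltW s0).
  have near3 : \forall s \near t, s < - r%:num -> t = - r%:num.
    have [->|tn] := eqVneq t (- r%:num); first by near=> s.
    have {}tn : - r%:num < t by rewrite lt_neqAle eq_sym tn.
    near=> s => s0; have : - r%:num < s by near: s; exact: lt_nbhsr.
    by rewrite ltNge (ltW s0).
  near=> s => st.
  have h2 : 0 < s -> t = 0 by near: s.
  have h3 : s < - r%:num -> t = - r%:num by near: s.
  have h1 : s != t -> I s ->
      `|df t - (s - t)^-1 * (f s - f t)| < e by near: s.
  have [sr|rs] := ltP s (- r%:num).
    by apply: quot => //; rewrite [in RHS]clamp_id // (h3 sr) /clamp sr.
  have [s0|s0] := ltP 0 s.
    apply: quot => //; rewrite [in RHS]clamp_id // (h2 s0) /clamp s0.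
    by rewrite ltNge rs.
  have Is : I s by rewrite /= in_itv /= rs s0.
  by rewrite !FE // clamp_id // distrC; exact: h1.
have dFE : derive1 F = df \o clamp by apply/funext => t; exact: (Fd t).2.
have FP : F \in C1seg_pred r.
  apply/mem_set; split.
  - by move=> t; exact: (Fd t).1.
  - rewrite dFE => t; apply/cvgrPdist_lt => e e0.
    have /cvgrPdist_lt/(_ _ e0) := dfc _ (clamp_in t).
    rewrite near_withinE => /nbhs_ballP[d /= d0 dH].
    apply/nbhs_ballP; exists d => //= s ts; apply: dH; last exact: clamp_in.
    by move: ts; rewrite -!ball_normE /=; apply: le_lt_trans; exact: clamp_lip.
  - move=> t tr; rewrite dFE /=; congr df.
    move: tr; rewrite le_eqVlt => /predU1P[->//|tr].
    by rewrite /clamp tr ltxx ltNge oppr_le0 ltW.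
  - move=> t t0; rewrite dFE /=; congr df.
    move: t0; rewrite le_eqVlt => /predU1P[<-//|t0].
    have rr := r0.
    have tN : (t < - r%:num) = false by apply/negbTE; rewrite -leNgt; lra.
    have zN : (0 < - r%:num) = false by apply/negbTE; rewrite -leNgt; lra.
    by rewrite /clamp t0 ltxx tN zN.
exists (MkC1seg FP) => [t It|psi psiE].
  by rewrite /= FE // dFE /= clamp_id.
pose chi : C1seg r := MkC1seg FP - psi.
have chi0 t : I t -> chi t = 0.
  by move=> It; change (F t - psi t = 0); rewrite psiE // FE // subrr.
have dchi0 t : I t -> derive1 chi t = 0.
  move=> It; apply/eqP; rewrite -normr_le0; apply/ler_addgt0Pl => e e0.
  rewrite addr0.
  have /nbhs_ballP[d /= d0 dH] := derive_diffquot (C1seg_derivable chi t) e0.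
  have rr := r0; have dr : 0 < Num.min (d / 2) (r%:num / 2).
    by rewrite lt_min !divr_gt0.
  have [m1 m2] : Num.min (d / 2) (r%:num / 2) <= d / 2 /\
      Num.min (d / 2) (r%:num / 2) <= r%:num / 2.
    by rewrite !ge_min !lexx orbT.
  set m := Num.min _ _ in dr m1 m2.
  have [s [sE Is st]] : exists s, [/\ `|t - s| = m, I s & s != t].
    move: (It); rewrite /= in_itv /= => /andP[t1 t2].
    have [ht|ht] := leP (- r%:num / 2) t.
      exists (t - m); split; rewrite /= ?in_itv /=.
      - by rewrite opprB addrCA subrr addr0 gtr0_norm.
      - by apply/andP; split; lra.
      - by apply/eqP; lra.
    exists (t + m); split; rewrite /= ?in_itv /=.
    - by rewrite opprD addrA subrr add0r normrN gtr0_norm.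
    - by apply/andP; split; lra.
    - by apply/eqP; lra.
  have H : `|(s - t)^-1 * (chi s - chi t) - derive1 chi t| < e.
    apply: (dH s) => //; rewrite -ball_normE /= sE.
    by apply: le_lt_trans m1 _; lra.
  by rewrite !chi0 // subrr mulr0 sub0r normrN in H; exact: ltW.
apply/esym/eqP; rewrite -subr_eq0 -normr_le0 C1seg_normE -[leRHS]addr0.
by apply: lerD; apply: normC_le => t ht; rewrite ?chi0 ?dchi0 ?normr0 //=
   ?in_itv.
Unshelve. all: by end_near. Qed.

End C1space_segment.

Section C1_calculus.
Context {R : realType}.
Implicit Types V W E : completeNormedModType R.

(* f is continuously differentiable on the open set U: Frechet differentiable
   with x |-> 'd f x continuous for the operator norm. *)
Definition C1_on V W (U : set V) (f : V -> W) : Prop :=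
  [/\ open U,
      forall x, U x -> differentiable f x
    & forall x, U x -> forall e : R, 0 < e ->
        \forall y \near x, forall h, `|'d f y h - 'd f x h| <= e * `|h|].

(* The same notion for functions of one real variable, where 'd f x h is
   h *: derive1 f x. *)
Definition C1_curve_on V (U : set R) (f : R -> V) : Prop :=
  [/\ open U, forall x, U x -> derivable f x 1
    & forall x, U x -> {for x, continuous (derive1 f)}].

(* f restricts to a diffeomorphism of the open set U onto the open set U'. *)
Definition C1_diffeo V W (U : set V) (U' : set W) (f : V -> W) : Prop :=
  C1_on U f /\
  exists g : W -> V,
    [/\ C1_on U' g,
        forall x, U x -> U' (f x) /\ g (f x) = x
      & forall y, U' y -> U (g y) /\ f (g y) = y].

Definition closed_subspace E (H : set E) : Prop :=
  [/\ closed H, H 0 & forall (a : R) u v, H u -> H v -> H (a *: u + v)].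

Definition complemented E (H : set E) : Prop :=
  closed_subspace H /\
  exists K : set E,
    [/\ closed_subspace K,
        H `&` K = [set 0]
      & forall x, exists u v, [/\ H u, K v & x = u + v]].

Definition C1_submanifold E (X : set E) : Prop :=
  forall x, X x ->
    exists (U U' : set E) (h : E -> E) (F : set E),
      [/\ U x, C1_diffeo U U' h, complemented F & h @` (X `&` U) = U' `&` F].

(* The standing assumptions on X and H are part of the predicate. *)
Definition almost_graph_diffeo E (O : set E) (A : E -> E) (X H : set E) : Prop :=
  [/\ C1_submanifold X,
      complemented H,
      open O /\ X `<=` O,
      exists O' : set E, C1_diffeo O O' A
    & A @` X `<=` H /\ forall z, (X `&` H) z -> A z = z].

End C1_calculus.

Section Delay_equation.
Context {R : realType}.
Variables (r : {posnum R}) (g d : R -> R).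
Local Notation C1 := (C1seg r).

(* ev0 is L, and ev_delay eta is L_eta. *)
Definition ev0 (phi : C1) : R := phi 0.

Definition ev_delay (eta : R) (phi : C1) : R := phi (- d eta).

Definition X_sol : set C1 :=
  [set phi : C1 | derive1 phi 0 = g (ev_delay (ev0 phi) phi)].

Definition T_sol (phi : C1) : set C1 :=
  [set chi : C1 | derive1 chi 0 =
     derive1 g (ev_delay (ev0 phi) phi) *
     (ev_delay (ev0 phi) chi
      - derive1 phi (- d (ev0 phi)) * derive1 d (ev0 phi) * ev0 chi)].

Definition X_zero : set C1 := [set chi : C1 | derive1 chi 0 = 0].

Variables (eta0 rho : R).

Definition c_const : R :=
  sup_on [set xi | `|xi - eta0| <= rho] g
  + sup_on [set xi | `|xi - eta0| <= rho] (derive1 g).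

Definition c_star : R := rho / (4 * (c_const + 1) * (rho + 3)).

(* psi eta0 is the separately chosen psi_eta0; the family indexed by
   eta != eta0 consists of the other values of psi. *)
Variables (a : R -> R) (psi : R -> C1).

Definition C1_near : set C1 :=
  [set phi : C1 | `|ev_delay (ev0 phi) phi - eta0| < rho / 2].

Definition C1_plus : set C1 := [set phi : C1 | 0 < d (ev0 phi)].

Definition A_near (phi : C1) : C1 :=
  phi - g (ev_delay (ev0 phi) phi) *: psi eta0.

Definition A_plus (phi : C1) : C1 :=
  let eta := ev0 phi in
  let tau := ev_delay eta phi in
  phi - g tau *: (a tau *: psi eta0 + (1 - a tau) *: psi eta).

(* By A_map_near and A_map_plus each formula holds on the whole of its domain,
   and by C1_near_plus_cover the two domains cover the space. *)
Definition A_map (phi : C1) : C1 :=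
  if `[< C1_near phi >] then A_near phi else A_plus phi.

Lemma C1_near_plus_cover : 0 < rho -> d eta0 = 0 ->
  (forall eta, eta != eta0 -> 0 < d eta) -> C1_near `|` C1_plus = setT.
Proof.
move=> rho0 d0 dpos; apply/seteqP; split=> // phi _.
have [E|ne] := eqVneq (ev0 phi) eta0; last by right; exact: dpos.
left; rewrite /C1_near /= /ev_delay E d0 oppr0.
by move: E; rewrite /ev0 => ->; rewrite subrr normr0 divr_gt0.
Qed.

Lemma A_map_near phi : C1_near phi -> A_map phi = A_near phi.
Proof. by move=> h; rewrite /A_map asboolT. Qed.

Lemma A_map_plus phi : (forall xi, `|xi - eta0| <= rho / 2 -> a xi = 1) ->
  C1_plus phi -> A_map phi = A_plus phi.
Proof.
move=> a1 _; rewrite /A_map; case: asboolP => // h.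
rewrite /A_near /A_plus (a1 _ (ltW h)).
by rewrite subrr scale0r addr0 scale1r.
Qed.

End Delay_equation.

(* Main.v *)
(* With eta = phi(0) and tau = phi(-d(eta)), the map is
   A(phi) = phi - g(tau) (a(tau) psi_eta0 + (1 - a(tau)) psi_eta) everywhere.
   Since every psi_eta vanishes at 0, A preserves eta; since psi_eta(-d(eta)) = 0,
   A changes tau into tau - (g a)(tau) psi_eta0(-d(eta)). The bound c_star makes
   t |-> t - (g a)(t) psi_eta0(-d(eta)) a perturbation of the identity of R with
   Lipschitz constant at most 1/4, so tau is recovered from (eta, A(phi)) by a
   scalar implicit equation, and A is a bijection of C^1 with inverse
   chi |-> chi + g(T) (a(T) psi_eta0 + (1 - a(T)) psi_eta), T = T(chi). As
   (A phi)'(0) = phi'(0) - g(tau), A maps X_f onto X_0, so that A itself is a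
   global submanifold chart. *)
Require Import Defs.
From HB Require Import structures.
From mathcomp Require Import all_boot all_order all_algebra.
From mathcomp Require Import all_classical all_reals all_analysis.
From mathcomp Require Import ring lra.
Import Order.TTheory GRing.Theory Num.Theory.
Import numFieldNormedType.Exports.
Local Open Scope ring_scope.
Local Open Scope classical_set_scope.
Set Implicit Arguments.
Unset Strict Implicit.

(** * Strict differentiability and its calculus rules *)

Section Strict_derivative.
Context {R : realType}.
Implicit Types V W Z : normedModType R.

(* Strict derivatives are stable under composition, products and implicit
   definition, and strict differentiability at every point is continuous
   differentiability (strictly_derivable_C1_on), so the continuity of
   derivatives never has to be tracked. *)
Definition strict_deriv {V W} (f : V -> W) (x : V) (L : V -> W) : Prop :=
  [/\ forall (c : R) u v, L (c *: u + v) = c *: L u + L v,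
      exists2 M : R, 0 < M & forall h, `|L h| <= M * `|h|
    & forall e : R, 0 < e -> \forall p \near (x, x),
        `|f p.1 - f p.2 - L (p.1 - p.2)| <= e * `|p.1 - p.2|].

Definition strictly_derivable {V W} (f : V -> W) (x : V) : Prop :=
  exists L, strict_deriv f x L.


(** Introduction rule that keeps later estimates crude: a constant factor [C] is removed by running
    the hypothesis with [Num.min (e / C) 1], and the restriction to [e <= 1] allows local bounds
    such as [|P x| + 1]. *)
Lemma strict_derivS V W (f : V -> W) x L (C : R) : 0 < C ->
  (forall (c : R) u v, L (c *: u + v) = c *: L u + L v) ->
  (exists M : R, forall h, `|L h| <= M * `|h|) ->
  (forall e : R, 0 < e <= 1 -> \forall p \near (x, x),
    `|f p.1 - f p.2 - L (p.1 - p.2)| <= C * e * `|p.1 - p.2|) ->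
  strict_deriv f x L.
Proof.
move=> C0 Ll [M LM] H; split=> //.
  exists (`|M| + 1); first by rewrite ltr_wpDl.
  move=> h; apply: le_trans (LM h) _; apply: ler_wpM2r => //.
  by apply: le_trans (ler_norm M) _; rewrite lerDl.
move=> e e0.
have m0 : 0 < Num.min (e / C) 1 <= 1.
  by rewrite lt_min divr_gt0 // ltr01 ge_min lexx orbT.
apply: filterS (H _ m0) => p /le_trans; apply.
rewrite ler_wpM2r // mulrC -ler_pdivlMr //.
by rewrite ge_min lexx.
Qed.

Lemma strict_deriv_lip V W (f : V -> W) x L : strict_deriv f x L ->
  exists2 M : R, 0 < M & \forall p \near (x, x),
    `|f p.1 - f p.2| <= M * `|p.1 - p.2|.
Proof.
move=> [_ [M M0 LM] H]; exists (M + 1); first by rewrite ltr_wpDl // ltW.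
apply: filterS (H 1 ltr01) => p Hp.
rewrite -[X in `|X|](subrK (L (p.1 - p.2))).
apply: le_trans (ler_normD _ _) _.
by rewrite mulrDl addrC lerD.
Qed.

(** Freezing the second point at [x] recovers the ordinary Frechet estimate from the strict one. *)
Lemma near_diag1 V (x : V) (P : set (V * V)) :
  (\forall p \near (x, x), P p) -> \forall y \near x, P (y, x).
Proof.
move=> [[A B] /= [Ax Bx] AB]; apply: filterS Ax => y Ay.
by apply: AB; split=> //=; exact: nbhs_singleton.
Qed.

Lemma near_fst V (x : V) (P : set V) :
  (\forall y \near x, P y) -> \forall p \near (x, x), P p.1.
Proof. by move=> H; exists (P, setT) => //=; [split=> //; exact: filterT | move=> p []]. Qed.

Lemma near_snd V (x : V) (P : set V) :
  (\forall y \near x, P y) -> \forall p \near (x, x), P p.2.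
Proof. by move=> H; exists (setT, P) => //=; [split=> //; exact: filterT | move=> p []]. Qed.

Lemma near_lip_cvg V W (f : V -> W) x (M : R) : 0 < M ->
  (\forall p \near (x, x), `|f p.1 - f p.2| <= M * `|p.1 - p.2|) ->
  {for x, continuous f}.
Proof.
move=> M0 /near_diag1 H.
apply/cvgrPdist_lt => e e0; near=> y.
rewrite distrC; apply: (@le_lt_trans _ _ (M * `|y - x|)).
  by near: y.
rewrite -ltr_pdivlMl // distrC; near: y.
by apply: cvgr_dist_lt => //; rewrite mulrC divr_gt0.
Unshelve. all: by end_near. Qed.

Lemma strictly_derivable_cvg V W (f : V -> W) x : strictly_derivable f x ->
  {for x, continuous f}.
Proof. by move=> [L /strict_deriv_lip[M M0]]; exact: near_lip_cvg. Qed.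

Lemma near_dist_le V W (f : V -> W) x : {for x, continuous f} ->
  forall e : R, 0 < e -> \forall y \near x, `|f y - f x| <= e.
Proof.
move=> fx e e0; near=> y; rewrite distrC; near: y.
exact: cvgr_dist_le.
Unshelve. all: by end_near. Qed.

Lemma near_diag_comp V W (f : V -> W) x (P : set (W * W)) :
  {for x, continuous f} ->
  (\forall p \near (f x, f x), P p) -> \forall p \near (x, x), P (f p.1, f p.2).
Proof.
move=> fx [[A B] /= [Ax Bx] AB].
exists (f @^-1` A, f @^-1` B) => /=; first by split; exact: fx.
by move=> p [h1 h2]; apply: AB.
Qed.

Lemma strictly_derivable_near_eq V W (f f' : V -> W) x :
  (\forall y \near x, f y = f' y) -> strictly_derivable f x ->
  strictly_derivable f' x.
Proof.
move=> ff' [L [Ll LM H]]; exists L; split=> // e /H He.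
have h1 := near_fst ff'; have h2 := near_snd ff'.
near=> p.
have <- : f p.1 = f' p.1 by near: p.
have <- : f p.2 = f' p.2 by near: p.
by near: p.
Unshelve. all: by end_near. Qed.

Lemma strictly_derivable_cst V W (w : W) (x : V) : strictly_derivable (fun=> w) x.
Proof.
exists (fun=> 0); apply: (@strict_derivS _ _ _ _ _ 1) => //.
- by move=> c u v; rewrite scaler0 addr0.
- by exists 0 => h; rewrite normr0 mul0r.
- by move=> e /andP[/ltW e0 _]; near=> p; rewrite !subrr normr0 mul1r mulr_ge0.
Unshelve. all: by end_near. Qed.

Lemma strictly_derivable_linear V W (L : V -> W) (x : V) (M : R) :
  (forall (c : R) u v, L (c *: u + v) = c *: L u + L v) ->
  (forall h, `|L h| <= M * `|h|) -> strictly_derivable L x.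
Proof.
move=> Ll LM; exists L; apply: (@strict_derivS _ _ _ _ _ 1) => //; first by exists M.
move=> e /andP[/ltW e0 _]; near=> p.
have -> : L (p.1 - p.2) = L p.1 - L p.2.
  by rewrite addrC -scaleN1r Ll scaleN1r addrC.
by rewrite subrr normr0 mul1r mulr_ge0.
Unshelve. all: by end_near. Qed.

Lemma strictly_derivableD V W (f k : V -> W) x :
  strictly_derivable f x -> strictly_derivable k x ->
  strictly_derivable (fun y => f y + k y) x.
Proof.
move=> [L [Ll [M M0 LM] Hf]] [K [Kl [N N0 KN] Hk]]; exists (fun h => L h + K h).
apply: (@strict_derivS _ _ _ _ _ 2) => //.
- by move=> c u v; rewrite Ll Kl scalerDr addrACA.
- by exists (M + N) => h; apply: le_trans (ler_normD _ _) _; rewrite mulrDl lerD.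
move=> e /andP[e0 _]; have {}Hf := Hf _ e0; have {}Hk := Hk _ e0; near=> p.
have -> : f p.1 + k p.1 - (f p.2 + k p.2) - (L (p.1 - p.2) + K (p.1 - p.2)) =
  (f p.1 - f p.2 - L (p.1 - p.2)) + (k p.1 - k p.2 - K (p.1 - p.2)).
  by rewrite addrACA -!opprD (addrACA _ (- f p.2)) -!opprD.
apply: le_trans (ler_normD _ _) _.
rewrite -mulrA mulr_natl mulr2n; apply: lerD; by near: p.
Unshelve. all: by end_near. Qed.

Lemma strictly_derivableN V W (f : V -> W) x :
  strictly_derivable f x -> strictly_derivable (fun y => - f y) x.
Proof.
move=> [L [Ll [M M0 LM] Hf]]; exists (fun h => - L h); split.
- by move=> c u v; rewrite Ll opprD scalerN.
- by exists M => // h; rewrite normrN.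
- by move=> e /Hf; apply: filterS => p; rewrite -!opprD normrN.
Qed.

Lemma strictly_derivableZ V W (u : V -> R) (P : V -> W) x :
  strictly_derivable u x -> strictly_derivable P x ->
  strictly_derivable (fun y => u y *: P y) x.
Proof.
move=> ux Px; have [L [Ll [M M0 LM] Hu]] := ux; have [K [Kl [N N0 KN] HP]] := Px.
exists (fun h => L h *: P x + u x *: K h).
have n1 := normr_ge0 (P x); have n2 := normr_ge0 (u x).
apply: (@strict_derivS _ _ _ _ _ (`|P x| + 1 + M + (`|u x| + 1) + N)).
- lra.
- move=> c v w; rewrite Ll Kl scalerDl !scalerDr !scalerA -addrACA.
  by rewrite (mulrC (u x)).
- exists (M * `|P x| + `|u x| * N) => h; apply: le_trans (ler_normD _ _) _.
  rewrite !normrZ mulrDl lerD //; last by rewrite -mulrA ler_wpM2l.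
  by rewrite mulrAC ler_wpM2r.
move=> e /andP[e0 e1]; have {}Hu := Hu _ e0; have {}HP := HP _ e0.
have P1 := near_fst (near_dist_le (strictly_derivable_cvg Px) e0).
have u2 := near_snd (near_dist_le (strictly_derivable_cvg ux) e0).
near=> p.
have hu : `|u p.1 - u p.2 - L (p.1 - p.2)| <= e * `|p.1 - p.2| by near: p.
have hP : `|P p.1 - P p.2 - K (p.1 - p.2)| <= e * `|p.1 - p.2| by near: p.
have hP1 : `|P p.1 - P x| <= e by near: p.
have hu2 : `|u p.2 - u x| <= e by near: p.
have hL := LM (p.1 - p.2); have hK := KN (p.1 - p.2).
have nP : `|P p.1| <= `|P x| + 1.
  by have := ler_normD (P p.1 - P x) (P x); rewrite subrK; lra.
have nu : `|u p.2| <= `|u x| + 1.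
  by have := ler_normD (u p.2 - u x) (u x); rewrite subrK; lra.
(* Each of the four summands contains exactly one small factor: the error of [u], the oscillation of
   [P], the error of [P], the oscillation of [u]. The remaining factors are bounded near [x]. *)
have -> : u p.1 *: P p.1 - u p.2 *: P p.2 -
    (L (p.1 - p.2) *: P x + u x *: K (p.1 - p.2)) =
  (u p.1 - u p.2 - L (p.1 - p.2)) *: P p.1 + L (p.1 - p.2) *: (P p.1 - P x)
  + u p.2 *: (P p.1 - P p.2 - K (p.1 - p.2)) + (u p.2 - u x) *: K (p.1 - p.2).
  rewrite !scalerBl !scalerBr opprD !addrA !subrK.
  by rewrite (addrAC _ _ (u p.2 *: P p.1)) subrK (addrAC _ _ (- (u p.2 *: P p.2))).
have b1 := ler_normD ((u p.1 - u p.2 - L (p.1 - p.2)) *: P p.1 +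
   L (p.1 - p.2) *: (P p.1 - P x) + u p.2 *: (P p.1 - P p.2 - K (p.1 - p.2)))
   ((u p.2 - u x) *: K (p.1 - p.2)).
have b2 := ler_normD ((u p.1 - u p.2 - L (p.1 - p.2)) *: P p.1 +
   L (p.1 - p.2) *: (P p.1 - P x)) (u p.2 *: (P p.1 - P p.2 - K (p.1 - p.2))).
have b3 := ler_normD ((u p.1 - u p.2 - L (p.1 - p.2)) *: P p.1)
   (L (p.1 - p.2) *: (P p.1 - P x)).
rewrite !normrZ in b1 b2 b3.
have h := normr_ge0 (p.1 - p.2).
have c1 := ler_pM (normr_ge0 _) (normr_ge0 _) hu nP.
have c2 := ler_pM (normr_ge0 _) (normr_ge0 _) hL hP1.
have c3 := ler_pM (normr_ge0 _) (normr_ge0 _) nu hP.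
have c4 := ler_pM (normr_ge0 _) (normr_ge0 _) hu2 hK.
lra.
Unshelve. all: by end_near. Qed.

Lemma strictly_derivable_comp V W Z (k : W -> Z) (f : V -> W) x :
  strictly_derivable f x -> strictly_derivable k (f x) ->
  strictly_derivable (fun y => k (f y)) x.
Proof.
move=> fx [K [Kl [N N0 KN] Hk]]; have [L Lf] := fx.
have [B B0 Hlip] := strict_deriv_lip Lf.
have [Ll [M M0 LM] Hf] := Lf.
exists (fun h => K (L h)); apply: (@strict_derivS _ _ _ _ _ (B + N)) => //.
- by rewrite addr_gt0.
- by move=> c u v; rewrite Ll Kl.
- exists (N * M) => h; apply: le_trans (KN _) _.
  by rewrite -mulrA ler_wpM2l // ltW.
move=> e /andP[e0 _]; have {}Hf := Hf _ e0.
have {}Hk := near_diag_comp (strictly_derivable_cvg fx) (Hk _ e0); near=> p.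
have hk : `|k (f p.1) - k (f p.2) - K (f p.1 - f p.2)| <= e * `|f p.1 - f p.2|.
  by near: p.
have hf : `|f p.1 - f p.2 - L (p.1 - p.2)| <= e * `|p.1 - p.2| by near: p.
have hl : `|f p.1 - f p.2| <= B * `|p.1 - p.2| by near: p.
(* The error splits into that of [k] at the images, measured in [f p.1 - f p.2] and hence costing
   the Lipschitz constant [B], and the image under [K] of the error of [f], costing [N]. *)
have KB : K (f p.1 - f p.2 - L (p.1 - p.2)) = K (f p.1 - f p.2) - K (L (p.1 - p.2)).
  by rewrite addrC -scaleN1r Kl scaleN1r addrC.
have := ler_normD (k (f p.1) - k (f p.2) - K (f p.1 - f p.2))
  (K (f p.1 - f p.2 - L (p.1 - p.2))).
rewrite KB addrA subrK => /le_trans; apply.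
rewrite -KB; have := KN (f p.1 - f p.2 - L (p.1 - p.2)).
nra.
Unshelve. all: by end_near. Qed.

End Strict_derivative.

(** * From strict differentiability to continuous differentiability *)

Section Strict_C1.
Context {R : realType}.

Lemma bounded_linear_cvg (V W : normedModType R) (L : V -> W) (M : R) :
  (forall (c : R) u v, L (c *: u + v) = c *: L u + L v) ->
  (forall h, `|L h| <= M * `|h|) -> continuous L.
Proof. by move=> Ll LM x; apply: strictly_derivable_cvg; exact: strictly_derivable_linear LM. Qed.

(** By homogeneity: any direction [h] is scaled by a small [t > 0] until [y + t h] enters the
    neighbourhood, and [t] then cancels. *)
Lemma linear_local_bound (V W : normedModType R) (D : V -> W) (y : V) (e : R) :
  (forall (c : R) u v, D (c *: u + v) = c *: D u + D v) ->
  (\forall z \near y, `|D (z - y)| <= e * `|z - y|) ->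
  forall h, `|D h| <= e * `|h|.
Proof.
move=> Dl H h.
have D0 : D 0 = 0.
  by have := Dl (-1) 0 0; rewrite scaler0 addr0 scaleN1r addNr.
have yh : (t *: h + y) @[t --> (0 : R)^'+] --> y.
  rewrite -[X in _ --> X]add0r -(scale0r h); apply: cvgD; last exact: cvg_cst.
  by apply: cvgZr_tmp; apply: cvg_within_filter; exact: cvg_id.
near (0 : R)^'+ => t.
have t0 : 0 < t by near: t; exact: nbhs_right_gt.
have : `|D (t *: h + y - y)| <= e * `|t *: h + y - y|.
  by near: t; exact: (yh _ H).
rewrite addrK -[t *: h]addr0 Dl D0 !addr0 !normrZ gtr0_norm // mulrCA.
by rewrite ler_pM2l.
Unshelve. all: by end_near. Qed.

Lemma strict_deriv_diff (V W : normedModType R) (f : V -> W) x L :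
  strict_deriv f x L -> differentiable f x /\ 'd f x = L :> (V -> W).
Proof.
move=> [Ll [M M0 LM] H].
pose lL := GRing.isLinear.Build R V W *:%R L Ll.
pose L' : {linear V -> W} := HB.pack L lL.
have cL : continuous L' by exact: bounded_linear_cvg Ll LM.
have fL : f \o shift x = cst (f x) + L' +o_ 0 id.
  apply/eqaddoP => _/posnumP[e].
  have e0 : 0 < e%:num by [].
  have := near_diag1 (H _ e0).
  rewrite (near_shift 0 x) subr0; apply: filterS => h /=.
  by rewrite addrK -addrA -opprD.
have dE := diff_unique cL fL; split=> //; apply/diff_locallyP; rewrite dE.
by split.
Qed.

(** For [y] near [x], the increments [f z - f y] with [z] close to [y] are approximated within
    [e / 2] both by the derivative at [x], since the strict estimate there covers the pair [(z, y)],
    and by the derivative at [y]. The two linear maps therefore differ by at most [e] near [y],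
    hence in operator norm. *)
Lemma strictly_derivable_C1_on (V W : completeNormedModType R) (f : V -> W) :
  (forall x, strictly_derivable f x) -> C1_on setT f.
Proof.
move=> fs; split; first exact: openT.
  by move=> x _; have [L /strict_deriv_diff[]] := fs x.
move=> x _ e e0; have [L fL] := fs x.
have [_ dE] := strict_deriv_diff fL; rewrite dE.
have [Ll _ H] := fL.
have e2 : 0 < e / 2 by rewrite divr_gt0.
have [[A B] /= [Ax Bx] AB] := H _ e2.
have Ax' := nbhs_interior Ax.
near=> y.
have Ay : \forall z \near y, A z by near: y.
have By : B y by near: y.
have [K fK] := fs y; have [_ dEy] := strict_deriv_diff fK; rewrite dEy.
have [Kl _ HK] := fK; have HKy := near_diag1 (HK _ e2).
apply: (@linear_local_bound _ _ (fun h => K h - L h) y).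
  by move=> c u v; rewrite Kl Ll scalerBr opprD addrACA.
near=> z.
have h1 : `|f z - f y - L (z - y)| <= e / 2 * `|z - y|.
  by apply: (AB (z, y)); split=> //=; near: z.
have h2 : `|f z - f y - K (z - y)| <= e / 2 * `|z - y| by near: z.
have -> : K (z - y) - L (z - y) =
    (f z - f y - L (z - y)) - (f z - f y - K (z - y)).
  by rewrite [in RHS]opprB [RHS]addrC addrA subrK.
apply: le_trans (ler_normB _ _) _.
have -> : e * `|z - y| = e / 2 * `|z - y| + e / 2 * `|z - y| by field.
exact: lerD.
Unshelve. all: by end_near. Qed.

End Strict_C1.

(** * Curves with continuous derivative are strictly differentiable *)

Section Curves.
Context {R : realType}.

(** The segment between two points of the ball stays in the ball, so the mean value theorem applies
    to [f] on it. Uniformity in the pair [y], [z] is what a strict derivative asks for. *)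
Lemma mean_value_le (f : R -> R) (l e x delta : R) :
  (forall t, `|t - x| < delta -> derivable f t 1) ->
  (forall t, `|t - x| < delta -> `|derive1 f t - l| <= e) ->
  forall y z, `|y - x| < delta -> `|z - x| < delta ->
  `|f y - f z - (y - z) * l| <= e * `|y - z|.
Proof.
move=> df dl y z; wlog zy : y z / z <= y.
  move=> H hy hz; have [zy|/ltW yz] := leP z y; first exact: H.
  have := H z y yz hz hy; rewrite -normrN (distrC z); congr (`|_| <= _).
  ring.
move=> hy hz.
have seg t : t \in `[z, y]%R -> `|t - x| < delta.
  rewrite in_itv /= => /andP[zt ty]; move: hy hz; rewrite !ltr_norml.
  by move=> /andP[? ?] /andP[? ?]; apply/andP; split; lra.
have fc : {within `[z, y], continuous f}.
  by apply: derivable_within_continuous => t /seg; exact: df.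
have [|c /seg hc ->] := @MVT_segment _ f (derive1 f) z y zy _ fc.
  move=> t /subset_itv_oo_cc /seg ht.
  exact: (DeriveDef (df _ ht) (esym (derive1E _ _))).
by rewrite (mulrC (y - z)) -mulrBl normrM ler_wpM2r // dl.
Qed.

Lemma functional_derive1 (V : normedModType R) (l : V -> R) (M : R) (f : R -> V) t :
  (forall (c : R) u v, l (c *: u + v) = c *: l u + l v) ->
  (forall h, `|l h| <= M * `|h|) -> derivable f t 1 ->
  derivable (l \o f) t 1 /\ derive1 (l \o f) t = l (derive1 f t).
Proof.
move=> ll lM df; rewrite !derive1E.
have l0 : l 0 = 0.
  by have := ll (-1) 0 0; rewrite scaler0 addr0 scaleN1r addNr.
have lB u v : l (u - v) = l u - l v.
  by rewrite addrC -scaleN1r ll scaleN1r addrC.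
have H : h^-1 *: (((l \o f) \o shift t) (h *: 1) - (l \o f) t) @[h --> (0:R)^']
    --> l ('D_1 f t).
  have -> : (fun h => h^-1 *: (((l \o f) \o shift t) (h *: 1) - (l \o f) t)) =
      l \o (fun h => h^-1 *: ((f \o shift t) (h *: 1) - f t)).
    apply/funext => h /=; rewrite -[in RHS](addr0 (_ *: _)) ll l0 addr0.
    by rewrite lB.
  by apply: cvg_comp df _; exact: (bounded_linear_cvg ll lM).
by split; [apply/cvg_ex; exists (l ('D_1 f t)) | exact: cvg_lim H].
Qed.

(* The mean value inequality for a vector-valued curve is reduced to the scalar
   one by testing against contractive functionals. *)
Lemma C1_curve_strict_deriv (V : completeNormedModType R) (C : R)
    (U : set R) (f : R -> V) x : 0 < C ->
  (forall (v : V) b, (forall l : V -> R,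
      (forall (c : R) u v, l (c *: u + v) = c *: l u + l v) ->
      (forall h, `|l h| <= 1 * `|h|) -> `|l v| <= b) -> `|v| <= C * b) ->
  C1_curve_on U f -> U x -> strict_deriv f x (fun h => h *: derive1 f x).
Proof.
move=> C0 norming [oU df cf] Ux.
apply: (@strict_derivS _ _ _ _ _ _ C) => //.
- by move=> c u v; rewrite scalerDl scalerA.
- by exists `|derive1 f x| => h; rewrite normrZ mulrC.
move=> e /andP[e0 _].
have NU : \forall t \near x, U t by exact: open_nbhs_nbhs.
have Nd : \forall t \near x, `|derive1 f t - derive1 f x| <= e.
  have /cvgrPdist_le/(_ _ e0) := cf _ Ux.
  by apply: filterS => t; rewrite distrC.
have NN : \forall t \near x, U t /\ `|derive1 f t - derive1 f x| <= e.
  by near=> t; split; near: t.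
have /nbhs_ballP[delta /= d0 Hd] := NN.
have Nb : \forall t \near x, ball x delta t by exact: nbhsx_ballx.
have b1 := near_fst Nb; have b2 := near_snd Nb.
(* A contractive [l] carries the bound on the variation of [derive1 f] over to [l \o f] with the
   same [e]; passing back to the norm costs only the factor [C]. *)
near=> p; rewrite -mulrA; apply: norming => l ll lM.
have bE t : `|t - x| < delta -> U t /\ `|derive1 f t - derive1 f x| <= e.
  by move=> tx; apply: Hd; rewrite -ball_normE /= distrC.
have lB u v : l (u - v) = l u - l v.
  by rewrite addrC -scaleN1r ll scaleN1r addrC.
have lZ c u : l (c *: u) = c * l u.
  by have := ll c u 0; rewrite addr0 => ->; rewrite -[in l 0](subrr u) lB subrr addr0.
rewrite !lB lZ.
apply: (@mean_value_le (l \o f) _ _ x delta).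
- by move=> t /bE[Ut _]; exact: (functional_derive1 ll lM (df _ Ut)).1.
- move=> t /bE[Ut dt]; rewrite (functional_derive1 ll lM (df _ Ut)).2 -lB.
  by apply: le_trans (lM _) _; rewrite mul1r.
- have : ball x delta p.1 by near: p.
  by rewrite -ball_normE /= distrC.
- have : ball x delta p.2 by near: p.
  by rewrite -ball_normE /= distrC.
Unshelve. all: by end_near. Qed.

Lemma C1_curve_real_strict_deriv (U : set R) (f : R -> R) x :
  C1_curve_on U f -> U x -> strict_deriv f x (fun h => h *: derive1 f x).
Proof.
apply: (@C1_curve_strict_deriv _ 1) => // v b H; rewrite mul1r.
by apply: (H id) => // h; rewrite mul1r.
Qed.

End Curves.

(** * The scalar implicit equation [t - k t * s = sg] *)

Section Implicit_scalar.
Context {R : realType}.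

(** Near [x] the map [L] differs from increments of [k] by an arbitrarily small multiple of the
    displacement; linearity makes the resulting bound global. *)
Lemma strict_deriv_bound_lip (V W : normedModType R) (k : V -> W) x L (K : R) :
  strict_deriv k x L -> (forall p q, `|k p - k q| <= K * `|p - q|) ->
  forall h, `|L h| <= K * `|h|.
Proof.
move=> [Ll _ Lk] kK h; apply/ler_addgt0Pr => e e0.
have n1 : 0 < `|h| + 1 by rewrite ltr_wpDl.
(* Dividing by [|h| + 1] keeps the contribution of this margin at the fixed [h] below [e], including
   for [h = 0]. *)
have e1 : 0 < e / (`|h| + 1) by rewrite divr_gt0.
have He := near_diag1 (Lk _ e1).
have := @linear_local_bound _ _ _ L x (K + e / (`|h| + 1)) Ll _ h.
move=> /(_ _)/le_trans; apply.
  near=> z.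
  have H : `|k z - k x - L (z - x)| <= e / (`|h| + 1) * `|z - x| by near: z.
  rewrite mulrDl -[L _](subKr (k z - k x)).
  by apply: le_trans (ler_normB _ _) _; apply: lerD.
rewrite mulrDl lerD2l -mulrA -[leRHS]mulr1 ler_wpM2l ?(ltW e0) //.
by rewrite ler_pdivrMl // mulr1 lerDl.
Unshelve. all: by end_near. Qed.

(** Differentiating the equation formally gives [(1 - k' s) tau' = sg' + k s'], whose coefficient is
    at least [1 / 2] since [|k' s| <= K c]. A local Lipschitz bound for [tau] comes first: it gives
    continuity of [tau] and turns errors measured in increments of [tau] into errors measured in
    increments of the argument. *)
Lemma strictly_derivable_implicit (V : normedModType R) (k : R -> R)
    (s sg tau : V -> R) x (K c B : R) :
  strictly_derivable s x -> strictly_derivable sg x ->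
  strictly_derivable k (tau x) ->
  (forall p q, `|k p - k q| <= K * `|p - q|) -> (forall p, `|k p| <= B) ->
  (forall y, `|s y| <= c) -> 0 <= K -> K * c <= 1 / 2 ->
  (forall y, tau y - k (tau y) * s y = sg y) ->
  strictly_derivable tau x.
Proof.
move=> sx sgx [L kL] kK kB sc K0 Kc tauE.
have [Ls sLs] := sx; have [Lsg sgL] := sgx.
have [Bs Bs0 lips] := strict_deriv_lip sLs.
have [Bsg Bsg0 lipsg] := strict_deriv_lip sgL.
have [Lsl [Ms Ms0 LsM] Hs] := sLs; have [Lsgl [Msg Msg0 LsgM] Hsg] := sgL.
have LK := strict_deriv_bound_lip kL kK.
have [Ll _ Hk] := kL.
have c0 : 0 <= c := le_trans (normr_ge0 _) (sc x).
have B0 : 0 <= B := le_trans (normr_ge0 _) (kB 0).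
pose k1 : R := L 1.
have LE h : L h = k1 * h.
  have L0 : L 0 = 0 by have := Ll (-1) 0 0; rewrite scaler0 addr0 scaleN1r addNr.
  have := Ll h 1 0; rewrite L0 !addr0 => H.
  by rewrite mulrC -[RHS]H; congr L; rewrite /GRing.scale /= mulr1.
have k1K : `|k1| <= K by have := LK 1; rewrite normr1 mulr1.
(* Subtracting the equations at two points bounds the increment of [tau] by [Bsg + B * Bs] times the
   distance plus [K * c] times the increment itself. Absorbing the latter, with [K * c <= 1 / 2],
   costs the factor 2. *)
pose La := 2 * (Bsg + B * Bs).
have La0 : 0 < La by rewrite /La mulr_gt0 // ltr_wpDr // mulr_ge0 // ltW.
have lipt : \forall p \near (x, x), `|tau p.1 - tau p.2| <= La * `|p.1 - p.2|.
  near=> p.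
  have h1 : `|s p.1 - s p.2| <= Bs * `|p.1 - p.2| by near: p.
  have h2 : `|sg p.1 - sg p.2| <= Bsg * `|p.1 - p.2| by near: p.
  have E : tau p.1 - tau p.2 = (sg p.1 - sg p.2) +
      (k (tau p.1) - k (tau p.2)) * s p.1 + k (tau p.2) * (s p.1 - s p.2).
    by rewrite -!tauE; ring.
  have b1 := ler_normD (sg p.1 - sg p.2 + (k (tau p.1) - k (tau p.2)) * s p.1)
    (k (tau p.2) * (s p.1 - s p.2)).
  have b2 := ler_normD (sg p.1 - sg p.2) ((k (tau p.1) - k (tau p.2)) * s p.1).
  rewrite -E !normrM in b1 b2.
  have b3 := ler_pM (normr_ge0 _) (normr_ge0 _) (kK (tau p.1) (tau p.2)) (sc p.1).
  have b4 := ler_pM (normr_ge0 _) (normr_ge0 _) (kB (tau p.2)) h1.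
  have b5 := ler_wpM2r (normr_ge0 (tau p.1 - tau p.2)) Kc.
  rewrite /La; lra.
have taux := near_lip_cvg La0 lipt.
pose m := 1 - k1 * s x.
have m2 : 1 / 2 <= m.
  have := ler_pM (normr_ge0 _) (normr_ge0 _) k1K (sc x).
  by rewrite -normrM => h; have := ler_norm (k1 * s x); rewrite /m; lra.
have m0 : 0 < m by lra.
exists (fun h => m^-1 * (Lsg h + k (tau x) * Ls h)).
(* The summands are the bounds of the error terms [e1], [e2], [e3], [e5] and [e4] below, not in that
   order; the factor 2 comes from dividing by [m >= 1 / 2]. *)
apply: (@strict_derivS _ _ _ _ _ _ (2 * (1 + La * c + K * La + K * Bs + B))).
- have : 0 <= La * c by rewrite mulr_ge0 // ltW.
  have : 0 <= K * La by rewrite mulr_ge0 // ltW.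
  have : 0 <= K * Bs by rewrite mulr_ge0 // ltW.
  lra.
- move=> a u v; rewrite Lsl Lsgl /GRing.scale /=; ring.
- exists (m^-1 * (Msg + B * Ms)) => h; rewrite normrM gtr0_norm ?invr_gt0 //.
  rewrite -mulrA ler_wpM2l ?invr_ge0 ?(ltW m0) //.
  apply: le_trans (ler_normD _ _) _; rewrite mulrDl lerD // normrM -mulrA.
  by apply: ler_pM.
move=> e /andP[e0 _]; have {}Hs := Hs _ e0; have {}Hsg := Hsg _ e0.
have {}Hk := near_diag_comp taux (Hk _ e0).
have s1 := near_fst (near_dist_le (strictly_derivable_cvg sx) e0).
have t2 := near_snd (near_dist_le taux e0).
near=> p; set h := p.1 - p.2.
have hk : `|k (tau p.1) - k (tau p.2) - L (tau p.1 - tau p.2)| <=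
  e * `|tau p.1 - tau p.2| by near: p.
have hs : `|s p.1 - s p.2 - Ls h| <= e * `|h| by rewrite /h; near: p.
have hsg : `|sg p.1 - sg p.2 - Lsg h| <= e * `|h| by rewrite /h; near: p.
have hs1 : `|s p.1 - s x| <= e by near: p.
have ht2 : `|tau p.2 - tau x| <= e by near: p.
have hls : `|s p.1 - s p.2| <= Bs * `|h| by rewrite /h; near: p.
have hlt : `|tau p.1 - tau p.2| <= La * `|h| by rewrite /h; near: p.
set E := (X in `|X|).
pose e1 := sg p.1 - sg p.2 - Lsg h.
pose e2 := (k (tau p.1) - k (tau p.2) - L (tau p.1 - tau p.2)) * s p.1.
pose e3 := k1 * (tau p.1 - tau p.2) * (s p.1 - s x).
pose e4 := (k (tau p.2) - k (tau x)) * (s p.1 - s p.2).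
pose e5 := k (tau x) * (s p.1 - s p.2 - Ls h).
(* Multiplying by [m] clears the inverse. The five terms are the errors of [sg] and of [k], the
   replacement of [s p.1] by [s x] and of [k (tau p.2)] by [k (tau x)], and the error of [s]. *)
have EE : m * E = e1 + e2 + e3 + e4 + e5.
  rewrite /E mulrBr mulVKf ?gt_eqF // /e1 /e2 /e3 /e4 /e5 -!tauE LE /m; ring.
have n0 := normr_ge0 h.
have b1 : `|e1| <= e * `|h| by [].
have b2 : `|e2| <= e * (La * `|h|) * c.
  rewrite normrM; apply: ler_pM => //; apply: le_trans hk _.
  by rewrite ler_wpM2l // ltW.
have b3 : `|e3| <= K * (La * `|h|) * e.
  by rewrite !normrM; apply: ler_pM => //; apply: ler_pM.
have b4 : `|e4| <= K * e * (Bs * `|h|).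
  rewrite normrM; apply: ler_pM => //; apply: le_trans (kK _ _) _.
  exact: ler_wpM2l.
have b5 : `|e5| <= B * (e * `|h|) by rewrite normrM; exact: ler_pM.
have : `|m * E| <= `|e1| + `|e2| + `|e3| + `|e4| + `|e5|.
  rewrite EE; do 4 ![apply: le_trans (ler_normD _ _) _; apply: lerD => //].
rewrite normrM (gtr0_norm m0) => b6.
have := ler_wpM2r (normr_ge0 E) m2.
lra.
Unshelve. all: by end_near. Qed.

(** Intermediate value theorem: the perturbation [k t * s] is at most [B * |s|] in absolute value,
    so [t - k t * s] takes values on both sides of [sg] at the ends [sg - B * |s|] and
    [sg + B * |s|]. *)
Lemma implicit_scalar_ex (k : R -> R) (K B s sg : R) : 0 <= K ->
  (forall p q, `|k p - k q| <= K * `|p - q|) -> (forall p, `|k p| <= B) ->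
  exists t, t - k t * s = sg.
Proof.
move=> K0 kK kB.
have kc : continuous k.
  move=> t; apply: (@near_lip_cvg _ _ _ _ _ (K + 1)); first by rewrite ltr_wpDl.
  near=> p; apply: le_trans (kK _ _) _; rewrite ler_wpM2r //; lra.
have B0 : 0 <= B := le_trans (normr_ge0 _) (kB 0).
have ks t : `|k t * s| <= B * `|s| by rewrite normrM ler_wpM2r.
have fc : continuous (fun t => t - k t * s).
  move=> t; apply: cvgB; first exact: cvg_id.
  by apply: cvgMr_tmp; exact: kc.
have Bs : 0 <= B * `|s| by rewrite mulr_ge0.
have [|||t _ tE] := @IVT _ (fun t => t - k t * s) (sg - B * `|s|) (sg + B * `|s|) sg.
- lra.
- exact: continuous_subspaceT.
- have h1 := ks (sg - B * `|s|); have h2 := ks (sg + B * `|s|).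
  rewrite !ler_norml in h1 h2; move: h1 h2 => /andP[? ?] /andP[? ?].
  rewrite ge_min le_max; apply/andP; split; apply/orP; [left|right]; lra.
by exists t.
Unshelve. all: by end_near. Qed.

(** Two solutions satisfy [|t - t'| <= K * c * |t - t'|], and [K * c <= 1 / 2] forces equality. *)
Lemma implicit_scalar_uniq (k : R -> R) (K c s t t' : R) :
  (forall p q, `|k p - k q| <= K * `|p - q|) -> 0 <= K -> K * c <= 1 / 2 ->
  `|s| <= c -> t - k t * s = t' - k t' * s -> t = t'.
Proof.
move=> kK K0 Kc sc E.
have E' : t - t' = (k t - k t') * s.
  by rewrite mulrBl; lra.
apply/eqP; rewrite -subr_eq0 -normr_le0.
have := ler_pM (normr_ge0 _) (normr_ge0 _) (kK t t') sc; rewrite -normrM -E'.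
have := ler_wpM2r (normr_ge0 (t - t')) Kc; lra.
Qed.

End Implicit_scalar.

(** * Strict differentiability on the space of C^1 segments *)

Section C1seg_strict.
Context {R : realType} {r : {posnum R}}.
Local Notation C1 := (C1seg r).

(** Point evaluations of a function and of its derivative are contractive functionals; the norm is
    the sum of the two suprema that they compute, whence the factor 2. *)
Lemma C1seg_norming (v : C1) (b : R) :
  (forall l : C1 -> R,
     (forall (c : R) u v, l (c *: u + v) = c *: l u + l v) ->
     (forall h, `|l h| <= 1 * `|h|) -> `|l v| <= b) -> `|v| <= 2 * b.
Proof.
move=> H; rewrite C1seg_normE mulr_natl mulr2n; apply: lerD; apply: normC_le => t ht.
- apply: (H (fun u : C1 => u t)) => // h; rewrite mul1r C1seg_normE.
  apply: le_trans (normC_ub (C1seg_continuous h) ht) _.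
  by rewrite lerDl normC_ge0 //; exact: C1seg_derive_continuous.
- apply: (H (fun u : C1 => derive1 u t)) => [c u w|h].
    exact: C1seg_derive_lin.
  by rewrite mul1r; exact: C1seg_deriv_le.
Qed.

Lemma C1seg_curve_strictly_derivable (U : set R) (f : R -> C1) x :
  C1_curve_on U f -> U x -> strictly_derivable f x.
Proof.
move=> fU Ux; exists (fun h => h *: derive1 f x).
by apply: (@C1_curve_strict_deriv _ _ 2 U) => // v b; exact: C1seg_norming.
Qed.

Lemma C1seg_strict_deriv (phi : C1) t :
  strict_deriv phi t (fun h => h *: derive1 phi t).
Proof.
apply: (@C1_curve_real_strict_deriv _ setT) => //; split=> // [|x _|x _].
- exact: openT.
- exact: C1seg_derivable.
- exact: C1seg_derive_continuous.
Qed.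

Lemma strictly_derivable_ev (t : R) (phi : C1) :
  strictly_derivable (fun chi : C1 => chi t) phi.
Proof.
by apply: (@strictly_derivable_linear _ _ _ _ _ (1 + `|t|)) => // h; exact: C1seg_eval_le.
Qed.

(** Evaluation at a state-dependent point. Moving the point costs [derive1 phi] at [s phi], so the
    derivative is [h t + d * L h]; the C^1 norm controls Lipschitz constants, which makes the
    estimate uniform in the function. *)
Lemma strictly_derivable_eval (s : C1 -> R) (phi : C1) :
  strictly_derivable s phi -> strictly_derivable (fun chi : C1 => chi (s chi)) phi.
Proof.
move=> sx; have [L sL] := sx.
have [B B0 lips] := strict_deriv_lip sL.
have [Ll [M M0 LM] Hs] := sL.
set t := s phi; set d := derive1 phi t.
have [_ _ Hphi] := C1seg_strict_deriv phi t.
have lip (chi : C1) p q : `|chi p - chi q| <= `|chi| * `|p - q|.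
  apply: le_trans (C1seg_lipschitz chi q p) _; rewrite ler_wpM2r //.
  by rewrite C1seg_normE lerDr normC_ge0 //; exact: C1seg_continuous.
exists (fun h : C1 => h t + d * L h).
apply: (@strict_derivS _ _ _ _ _ _ (1 + B + B + `|d|)).
- by have := normr_ge0 d; lra.
- move=> c u v; rewrite Ll.
  change (c * u t + v t + d * (c * L u + L v) = c * (u t + d * L u) + (v t + d * L v)).
  ring.
- exists (1 + `|t| + `|d| * M) => h; apply: le_trans (ler_normD _ _) _.
  rewrite mulrDl lerD ?C1seg_eval_le // normrM -mulrA.
  exact: ler_wpM2l.
move=> e /andP[e0 _]; have {}Hs := Hs _ e0.
have {}Hphi := near_diag_comp (strictly_derivable_cvg sx) (Hphi _ e0).
have s1 := near_fst (near_dist_le (strictly_derivable_cvg sx) e0).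
have id2 : \forall p \near (phi, phi), `|p.2 - phi| <= e.
  apply: (@near_snd _ _ _ (fun y => `|y - phi| <= e)).
  by apply: (@near_dist_le _ _ _ id) => //; exact: cvg_id.
near=> p; set h := p.1 - p.2; set u := s p.1; set v := s p.2.
have h1 : `|u - t| <= e by rewrite /u /t; near: p.
have h2 : `|u - v| <= B * `|h| by rewrite /u /v /h; near: p.
have h3 : `|u - v - L h| <= e * `|h| by rewrite /u /v /h; near: p.
have h4 : `|phi u - phi v - (u - v) *: d| <= e * `|u - v|.
  by rewrite /u /v; near: p.
have h5 : `|p.2 - phi| <= e by near: p.
(* In turn: moving the evaluation point of [h] from [t] to [u], the error of [phi] at [t], replacing
   [p.2] by [phi] (their difference has Lipschitz constant at most [e]), and the error of [s]. *)
pose e1 := h u - h t; pose e2 := phi u - phi v - (u - v) *: d.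
pose e3 := (p.2 - phi) u - (p.2 - phi) v; pose e4 := d * (u - v - L h).
have -> : p.1 u - p.2 v - (h t + d * L h) = e1 + e2 + e3 + e4.
  rewrite /e1 /e2 /e3 /e4 /h.
  change (p.1 u - p.2 v - (p.1 t - p.2 t + d * L h) =
    p.1 u - p.2 u - (p.1 t - p.2 t) + (phi u - phi v - (u - v) * d)
    + (p.2 u - phi u - (p.2 v - phi v)) + d * (u - v - L h)).
  ring.
have b1 : `|e1| <= `|h| * e.
  by apply: le_trans (lip h u t) _; exact: ler_wpM2l.
have b2 : `|e2| <= e * (B * `|h|).
  by apply: le_trans h4 _; rewrite ler_wpM2l // ltW.
have b3 : `|e3| <= e * (B * `|h|).
  by apply: le_trans (lip _ u v) _; exact: ler_pM.
have b4 : `|e4| <= `|d| * (e * `|h|) by rewrite normrM ler_wpM2l.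
have : `|e1 + e2 + e3 + e4| <= `|e1| + `|e2| + `|e3| + `|e4|.
  by do 3 ![apply: le_trans (ler_normD _ _) _; apply: lerD => //].
lra.
Unshelve. all: by end_near. Qed.

End C1seg_strict.

(** * Kernels of bounded functionals are complemented *)

Section Hyperplanes.
Context {R : realType}.

Lemma closed_subspace_kernel (V W : completeNormedModType R) (L : V -> W) (M : R) :
  (forall (c : R) u v, L (c *: u + v) = c *: L u + L v) ->
  (forall h, `|L h| <= M * `|h|) -> closed_subspace [set x | L x = 0].
Proof.
move=> Ll LM; split=> /=.
- rewrite (_ : [set x | L x = 0] = (fun x => `|L x|) @^-1` [set y | y <= 0]).
    apply: preimage_closed; last exact: closed_le.
    by move=> x _; apply: cvg_norm; exact: (bounded_linear_cvg Ll LM).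
  apply/seteqP; split=> x /=; first by move=> ->; rewrite normr0.
  by rewrite normr_le0 => /eqP.
- by have := Ll (-1) 0 0; rewrite scaler0 addr0 scaleN1r addNr.
- by move=> c u v Lu Lv; rewrite Ll Lu Lv scaler0 addr0.
Qed.

(** The complement is the line spanned by [v], written as the kernel of [x - l x v] so that its
    closedness follows from [closed_subspace_kernel] again. *)
Lemma complemented_kernel (V : completeNormedModType R) (l : V -> R) (M : R) (v : V) :
  (forall (c : R) u w, l (c *: u + w) = c * l u + l w) ->
  (forall h, `|l h| <= M * `|h|) -> l v = 1 -> complemented [set x | l x = 0].
Proof.
move=> ll lM lv; split; first exact: closed_subspace_kernel lM.
have l0 : l 0 = 0 by have := ll (-1) 0 0; rewrite scaler0 addr0 mulN1r addNr.
have lZ c : l (c *: v) = c by rewrite -[_ *: _]addr0 ll lv l0 mulr1 addr0.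
exists [set x | x - l x *: v = 0]; split.
- apply: (@closed_subspace_kernel _ _ _ (1 + M * `|v|)).
    move=> c u w; rewrite ll scalerBr scalerDl scalerA opprD.
    by rewrite addrACA.
  move=> h; apply: le_trans (ler_normB _ _) _; rewrite mulrDl mul1r lerD2l.
  by rewrite normrZ mulrAC ler_wpM2r.
- apply/seteqP; split=> x /=.
    by move=> [lx]; rewrite lx scale0r subr0.
  by move=> ->; rewrite l0 scale0r subr0.
- move=> x; exists (x - l x *: v), (l x *: v); split=> /=.
  + by rewrite addrC -scaleNr ll lv mulr1 addNr.
  + by rewrite lZ subrr.
  + by rewrite subrK.
Qed.

End Hyperplanes.

(** * Bounds for the truncated nonlinearity [g a] *)

Section Cutoff.
Context {R : realType}.
Context (g a : R -> R) (eta0 rho : R).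

Lemma sup_on_ball_ub (f : R -> R) xi : continuous f -> `|xi - eta0| <= rho ->
  `|f xi| <= sup_on [set x | `|x - eta0| <= rho] f.
Proof.
move=> cf hxi.
have -> : [set x | `|x - eta0| <= rho] = `[eta0 - rho, eta0 + rho].
  by apply/seteqP; split=> x /=; rewrite in_itv /= ler_distl.
by apply: sup_on_ub => //; rewrite -ler_distl.
Qed.

Lemma C1_curve_continuous (f : R -> R) : C1_curve_on setT f ->
  continuous f /\ continuous (derive1 f).
Proof.
move=> [_ df cf]; split=> x; last exact: cf.
by apply: differentiable_continuous; apply/derivable1_diffP; exact: df.
Qed.

Lemma near_derive1_cst (f : R -> R) (x b : R) :
  (\forall y \near x, f y = b) -> derive1 f x = 0.
Proof.
move=> fb; have -> : derive1 f x = derive1 (cst b) x; last by rewrite derive1_cst.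
by rewrite !derive1E; apply: near_eq_derive => //; rewrite oner_neq0.
Qed.

(** On the ball of radius [rho] the product rule gives [|(g a)'| <= c + c * (3 / rho)], which is
    [c * (rho + 3) / rho]; outside the ball [g a] vanishes. *)
Lemma cutoff_bounds : 0 < rho -> C1_curve_on setT g -> C1_curve_on setT a ->
  (forall xi, 0 <= a xi <= 1) ->
  (forall xi, `|xi - eta0| <= rho / 2 -> a xi = 1) ->
  (forall xi, rho <= `|xi - eta0| -> a xi = 0) ->
  (forall xi, rho / 2 <= `|xi - eta0| <= rho -> `|derive1 a xi| <= 3 / rho) ->
  let c := c_const g eta0 rho in
  [/\ 0 <= c, forall p, `|g p * a p| <= c &
      forall p q, `|g p * a p - g q * a q| <= c * (rho + 3) / rho * `|p - q|].
Proof.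
move=> rho0 gC aC a01 a1 a0 da c.
have [gc dgc] := C1_curve_continuous gC; have [_ gd _] := gC; have [_ ad _] := aC.
pose s0 := sup_on [set x | `|x - eta0| <= rho] g.
pose s1 := sup_on [set x | `|x - eta0| <= rho] (derive1 g).
have cE : c = s0 + s1 by [].
have gb xi : `|xi - eta0| <= rho -> `|g xi| <= s0 by exact: sup_on_ball_ub.
have dgb xi : `|xi - eta0| <= rho -> `|derive1 g xi| <= s1 by exact: sup_on_ball_ub.
have hr : `|eta0 - eta0| <= rho by rewrite subrr normr0 ltW.
have s00 : 0 <= s0 := le_trans (normr_ge0 _) (gb _ hr).
have s10 : 0 <= s1 := le_trans (normr_ge0 _) (dgb _ hr).
have cn0 : 0 <= c by rewrite cE addr_ge0.
have an xi : `|a xi| <= 1 by have /andP[? ?] := a01 xi; rewrite ger0_norm.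
have r30 : 0 <= 3 / rho by rewrite divr_ge0 // ltW.
split=> // [p|p q].
  have [h|/ltW h] := leP `|p - eta0| rho; last by rewrite a0 // mulr0 normr0.
  rewrite normrM -[leRHS]mulr1; apply: ler_pM => //.
  by apply: le_trans (gb _ h) _; rewrite cE lerDl.
have dist_cont x : {for x, continuous (fun y : R => `|y - eta0|)}.
  by apply: cvg_norm; apply: cvgB; [exact: cvg_id | exact: cvg_cst].
(* The bound on [derive1 a] is assumed only on the annulus; in the inner ball [a] is locally 1 and
   its derivative is zero. *)
have dab x : `|x - eta0| <= rho -> `|derive1 a x| <= 3 / rho.
  move=> h; have [h2|h2] := leP (rho / 2) `|x - eta0|; first by apply: da; rewrite h2.
  rewrite (@near_derive1_cst _ _ 1) ?normr0 //.
  have H : \forall y \near x, `|y - eta0| < rho / 2.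
    exact: (dist_cont x _ (lt_nbhsl h2)).
  by apply: filterS H => y /ltW; exact: a1.
have kd x : derivable (g * a) x 1 by apply: derivableM; [exact: gd | exact: ad].
have kb x : `|derive1 (g * a) x| <= c * (rho + 3) / rho.
  have [h|h] := leP `|x - eta0| rho; last first.
    rewrite (@near_derive1_cst _ _ 0).
      by rewrite normr0 divr_ge0 ?mulr_ge0 ?addr_ge0 // ltW.
    have H : \forall y \near x, rho < `|y - eta0|.
      exact: (dist_cont x _ (lt_nbhsr h)).
    apply: filterS H => y /ltW /a0 ay.
    by change (g y * a y = 0); rewrite ay mulr0.
  rewrite derive1E deriveM; [|exact: gd|exact: ad].
  rewrite -!derive1E; apply: le_trans (ler_normD _ _) _; rewrite !normrZ.
  have -> : c * (rho + 3) / rho = c + c * (3 / rho).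
    by field; rewrite gt_eqF.
  have h1 := ler_pM (normr_ge0 _) (normr_ge0 _) (gb _ h) (dab _ h).
  have h2 := ler_pM (normr_ge0 _) (normr_ge0 _) (an x) (dgb _ h).
  have h3 := mulr_ge0 s10 r30.
  rewrite cE; lra.
(* Slope 0 turns the estimate into a Lipschitz bound; the radius [|p - q| + 1] about [q] puts both
   points into the ball. *)
have := @mean_value_le _ (g * a) 0 (c * (rho + 3) / rho) q (`|p - q| + 1).
move=> /(_ _ _ p q); rewrite mulr0 subr0; apply=> //.
- by move=> t _; rewrite subr0.
- by rewrite ltrDl.
- by rewrite subrr normr0 ltr_wpDl.
Qed.

End Cutoff.

(** * Differentiability of the perturbation term *)

Section Shear.
Context {R : realType} {r : {posnum R}}.
Local Notation C1 := (C1seg r).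

(* psi need not be continuous at eta0: near that value the factor l vanishes. *)
Lemma strictly_derivable_shear (k l : R -> R) (psi : R -> C1) (eta0 delta : R)
    (tau : C1 -> R) (phi : C1) : 0 < delta ->
  (forall t, strictly_derivable k t) -> (forall t, strictly_derivable l t) ->
  C1_curve_on [set eta | eta != eta0] psi ->
  (forall t, `|t - eta0| <= delta -> l t = 0) ->
  strictly_derivable tau phi -> (phi 0 = eta0 -> tau phi = eta0) ->
  strictly_derivable
    (fun chi : C1 => k (tau chi) *: psi eta0 + l (tau chi) *: psi (chi 0)) phi.
Proof.
move=> d0 ks ls psiC l0 tau_s tau0; apply: strictly_derivableD.
  apply: strictly_derivableZ; last exact: strictly_derivable_cst.
  exact: strictly_derivable_comp (ks _).
have [E|ne] := eqVneq (phi 0) eta0.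
  (* For [chi] near [phi] the value [chi 0] may differ from [eta0], but continuity keeps [tau chi]
     within [delta] of [eta0]. *)
  apply: (@strictly_derivable_near_eq _ _ _ (fun=> 0)).
    have := near_dist_le (strictly_derivable_cvg tau_s) d0.
    apply: filterS => chi; rewrite (tau0 E) => /l0 ->.
    by rewrite scale0r.
  exact: strictly_derivable_cst.
apply: strictly_derivableZ; first exact: strictly_derivable_comp (ls _).
apply: (@strictly_derivable_comp _ _ _ _ psi (fun chi : C1 => chi 0)).
  exact: strictly_derivable_ev.
exact: C1seg_curve_strictly_derivable psiC ne.
Qed.

End Shear.

(** * The map [A], its inverse, and the conclusion *)

Unset Implicit Arguments.
Theorem corollary1 (R : realType) (r : {posnum R}) (g d : R -> R)
    (eta0 rho : R) (psi : R -> C1seg r) (a : R -> R)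
    (g_C1 : C1_curve_on setT g)
    (d_C1 : C1_curve_on setT d)
    (d_range : forall x, 0 <= d x <= r%:num)
    (d_eta0 : d eta0 = 0)
    (d_pos : forall eta, eta != eta0 -> 0 < d eta)
    (rho_gt0 : 0 < rho)
    (psi0_at0 : psi eta0 0 = 0)
    (psi0_deriv : derive1 (psi eta0) 0 = 1)
    (psi0_norm : normC r (psi eta0) <= c_star g eta0 rho)
    (psi_C1 : C1_curve_on [set eta | eta != eta0] psi)
    (psi_null : forall eta, eta != eta0 ->
       forall t, - r%:num <= t <= - d eta \/ t = 0 -> psi eta t = 0)
    (psi_deriv : forall eta, eta != eta0 -> derive1 (psi eta) 0 = 1)
    (psi_norm : forall eta, eta != eta0 ->
       normC r (psi eta) <= c_star g eta0 rho)
    (psi_transversal : forall eta, eta != eta0 ->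
       forall phi, X_sol g d phi -> ev0 phi = eta -> ~ T_sol g d phi (psi eta))
    (a_C1 : C1_curve_on setT a)
    (a_range : forall xi, 0 <= a xi <= 1)
    (a_one : forall xi, `|xi - eta0| <= rho / 2 -> a xi = 1)
    (a_zero : forall xi, rho <= `|xi - eta0| -> a xi = 0)
    (a_deriv : forall xi, rho / 2 <= `|xi - eta0| <= rho ->
       `|derive1 a xi| <= 3 / rho) :
  almost_graph_diffeo setT (A_map g d eta0 rho a psi) (X_sol g d) (@X_zero R r).
Proof.
have [c0 kB kK] := cutoff_bounds rho_gt0 g_C1 a_C1 a_range a_one a_zero a_deriv.
set c := c_const g eta0 rho in c0 kB kK; set K := c * (rho + 3) / rho in kK.
pose k t := g t * a t; pose l t := g t * (1 - a t).
pose Psi eta t : C1seg r := k t *: psi eta0 + l t *: psi eta.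
pose s (phi : C1seg r) := psi eta0 (- d (phi 0)).
pose tau (phi : C1seg r) := phi (- d (phi 0)).
have K0 : 0 <= K by rewrite /K divr_ge0 ?(ltW rho_gt0) // mulr_ge0 // addr_ge0 // ltW.
(* The factors [rho] and [rho + 3] cancel. *)
have Kc : K * c_star g eta0 rho <= 1 / 2.
  have -> : K * c_star g eta0 rho = c / (4 * (c + 1)).
    rewrite /K /c_star -/c; field.
    by apply/and3P; split; apply/eqP; lra.
  by rewrite ler_pdivrMr; lra.
have sc phi : `|s phi| <= c_star g eta0 rho.
  apply: le_trans psi0_norm; apply: normC_ub; first exact: C1seg_continuous.
  by have /andP[h1 h2] := d_range (phi 0); rewrite oppr_le0 h1 lerN2 h2.
have psi00 eta : psi eta 0 = 0.
  by have [->//|ne] := eqVneq eta eta0; apply: psi_null => //; right.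
have psiN eta : psi eta (- d eta) = 0.
  have [->|ne] := eqVneq eta eta0; first by rewrite d_eta0 oppr0.
  apply: psi_null => //; left; rewrite lexx andbT lerN2.
  by case/andP: (d_range eta).
have psi' eta : derive1 (psi eta) 0 = 1.
  by have [->//|ne] := eqVneq eta eta0; exact: psi_deriv.
have Psi0 eta t : Psi eta t 0 = 0.
  by change (k t * psi eta0 0 + l t * psi eta 0 = 0); rewrite !psi00 !mulr0 addr0.
have PsiN eta t : Psi eta t (- d eta) = k t * psi eta0 (- d eta).
  change (k t * psi eta0 (- d eta) + l t * psi eta (- d eta) = k t * psi eta0 (- d eta)).
  by rewrite psiN mulr0 addr0.
have Psi' eta t : derive1 (Psi eta t) 0 = g t.
  by rewrite C1seg_deriveD !C1seg_deriveZ !psi' /k /l; ring.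
pose A := A_map g d eta0 rho a psi.
(* The formula near [eta0] is the case [a (tau phi) = 1], where [l] vanishes and [k] equals [g]. *)
have AE phi : A phi = phi - Psi (phi 0) (tau phi).
  rewrite /A /A_map; case: asboolP => h; rewrite /A_near /A_plus /Psi /k /l /tau.
    by rewrite a_one ?(ltW h) // subrr mulr0 scale0r addr0 mulr1.
  by rewrite scalerDr !scalerA.
have /choice[T TE] : forall chi, exists t, t - k t * s chi = tau chi.
  by move=> chi; exact: implicit_scalar_ex K0 kK kB.
pose B (chi : C1seg r) : C1seg r := chi + Psi (chi 0) (T chi).
have A0 phi : A phi 0 = phi 0.
  rewrite AE; change (phi 0 - Psi (phi 0) (tau phi) 0 = phi 0).
  by rewrite Psi0 subr0.
have B0 chi : B chi 0 = chi 0.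
  change (chi 0 + Psi (chi 0) (T chi) 0 = chi 0).
  by rewrite Psi0 addr0.
have tauB chi : tau (B chi) = T chi.
  rewrite {1}/tau B0.
  change (chi (- d (chi 0)) + Psi (chi 0) (T chi) (- d (chi 0)) = T chi).
  by rewrite PsiN -/(tau chi) -TE -/(s chi) subrK.
have tauA phi : tau (A phi) = tau phi - k (tau phi) * s phi.
  rewrite {1}/tau A0 AE.
  change (phi (- d (phi 0)) - Psi (phi 0) (tau phi) (- d (phi 0)) =
    tau phi - k (tau phi) * s phi).
  by rewrite PsiN.
have sA phi : s (A phi) = s phi by rewrite /s A0.
(* Both sides solve the scalar equation with coefficient [s phi] and right-hand side [tau (A phi)],
   because [A] leaves [s] unchanged. *)
have TA phi : T (A phi) = tau phi.
  apply: (implicit_scalar_uniq kK K0 Kc (sc phi)).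
  by rewrite -[in LHS]sA TE tauA.
have AB chi : A (B chi) = chi by rewrite AE tauB B0 /B addrK.
have BA phi : B (A phi) = phi by rewrite /B TA A0 AE subrK.
have A' phi : derive1 (A phi) 0 = derive1 phi 0 - g (tau phi).
  by rewrite AE C1seg_deriveB Psi'.
have XA phi : X_sol g d phi <-> X_zero (A phi).
  rewrite /X_sol /X_zero /= A' /ev_delay /ev0 -/(tau phi).
  by split=> [->|/eqP]; rewrite ?subrr // subr_eq0 => /eqP.
have gs t : strictly_derivable g t.
  by exists (fun h => h *: derive1 g t); exact: C1_curve_real_strict_deriv g_C1 I.
have as_ t : strictly_derivable a t.
  by exists (fun h => h *: derive1 a t); exact: C1_curve_real_strict_deriv a_C1 I.
have ds t : strictly_derivable d t.
  by exists (fun h => h *: derive1 d t); exact: C1_curve_real_strict_deriv d_C1 I.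
have ks t : strictly_derivable k t by apply: (strictly_derivableZ (gs t) (as_ t)).
have ls t : strictly_derivable l t.
  apply: (strictly_derivableZ (gs t)); apply: strictly_derivableD.
    exact: strictly_derivable_cst.
  exact: strictly_derivableN.
have l0 t : `|t - eta0| <= rho / 2 -> l t = 0.
  by move=> /a_one at1; rewrite /l at1 subrr mulr0.
have dels phi : strictly_derivable (fun chi : C1seg r => - d (chi 0)) phi.
  apply: strictly_derivableN.
  exact: strictly_derivable_comp (strictly_derivable_ev 0 phi) (ds _).
have taus phi : strictly_derivable tau phi by exact: strictly_derivable_eval.
have ss phi : strictly_derivable s phi.
  apply: (@strictly_derivable_comp _ _ _ _ (psi eta0) (fun chi : C1seg r => - d (chi 0))).
    exact: dels.
  by eexists; exact: C1seg_strict_deriv.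
have Ts phi : strictly_derivable T phi.
  exact: strictly_derivable_implicit (ss phi) (taus phi) (ks _) kK kB sc K0 Kc TE.
have tau0 (phi : C1seg r) : phi 0 = eta0 -> tau phi = eta0.
  by move=> E; rewrite /tau E d_eta0 oppr0.
(* [T] is [tau] after [B], and [B] preserves the value at 0, so the condition at [eta0] passes from
   [tau] to [T]. *)
have T0 (phi : C1seg r) : phi 0 = eta0 -> T phi = eta0.
  by move=> E; rewrite -tauB; apply: tau0; rewrite B0.
have r2 : 0 < rho / 2 by rewrite divr_gt0.
have ids (phi : C1seg r) : strictly_derivable (id : C1seg r -> C1seg r) phi.
  by apply: (@strictly_derivable_linear _ _ _ _ _ 1) => // h; rewrite mul1r.
have C1A : C1_on setT A.
  rewrite (_ : A = fun phi => phi - Psi (phi 0) (tau phi)); last exact/funext.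
  apply: strictly_derivable_C1_on => phi; apply: strictly_derivableD => //.
  apply: strictly_derivableN.
  exact: strictly_derivable_shear r2 ks ls psi_C1 l0 (taus phi) (@tau0 phi).
have C1B : C1_on setT B.
  apply: strictly_derivable_C1_on => phi; apply: strictly_derivableD => //.
  exact: strictly_derivable_shear r2 ks ls psi_C1 l0 (Ts phi) (@T0 phi).
have diffA : C1_diffeo setT setT A by split=> //; exists B; split.
have compl : complemented (@X_zero R r).
  apply: (@complemented_kernel _ _ (fun chi : C1seg r => derive1 chi 0) 1 (psi eta0)) => //.
    by move=> c' u w; exact: C1seg_derive_lin.
  by move=> h; rewrite mul1r; exact: C1seg_deriv_le.
split=> //.
(* A single chart serves for every point: [A] on the whole space, with model subspace [X_zero]. *)
- move=> phi _; exists setT, setT, A, (@X_zero R r); split=> //.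
  rewrite setIT setTI; apply/seteqP; split=> [_ [chi /XA ? <-]//|chi chi0].
  by exists (B chi) => //; apply/XA; rewrite AB.
- by split; [exact: openT | move].
- by exists setT.
- split=> [_ [phi /XA ? <-]//|phi [phiX phi0]].
  (* On the intersection, [phi'(0)] equals both [g (tau phi)] and 0, so both coefficients of the
     perturbation vanish. *)
  have g0 : g (tau phi) = 0.
    by move: phiX phi0; rewrite /X_sol /X_zero /= /ev_delay /ev0 -/(tau phi) => <-.
  by rewrite -/(A phi) AE /Psi /k /l g0 !mul0r !scale0r addr0 subr0.
Qed.
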